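(* Let $m,a\ge0$ and $\ell\ge1$ be integers, and let $\mathcal{C}^0_\ell(m,a)$ be the arrangement in $\mathbb{R}^\ell$ consisting of the hyperplanes $x_i+x_j=s$ and $x_i-x_j=s$ for $1\le i<j\le\ell$ and integers $-a\le s\le a$, and $2x_i=s$ for $1\le i\le\ell$ and integers $-m\le s\le m$. Then the cone $\mathbf{c}\mathcal{C}^0_\ell(m,a)$ is flag-accurate. In particular, the extended Catalan arrangement $\mathrm{Cat}^m(C_\ell)=\mathcal{C}^0_\ell(m,m)$ of type $C_\ell$ has flag-accurate cone with exponents $(1,\ 2m\ell+2i-1)_{i=1}^{\ell}$.
   Context: For an affine arrangement $\mathcal{A}$ in $\mathbb{R}^\ell$, its cone $\mathbf{c}\mathcal{A}$ is the central arrangement in $V'=\mathbb{R}^{\ell+1}$ (extra coordinate $z$) consisting of the hyperplanes $a_1x_1+\dots+a_\ell x_\ell=dz$ for each hyperplane $a_1x_1+\dots+a_\ell x_\ell=d$ of $\mathcal{A}$, together with $z=0$. For a central arrangement $\mathcal{A}$ in $W=\mathbb{R}^n$: $L(\mathcal{A})$ is the set of intersections of subsets of $\mathcal{A}$ (including $W$); $\mathcal{A}^X=\{H\cap X:H\in\mathcal{A},X\not\subseteq H\}$; $\mathcal{A}$ is free if $D(\mathcal{A})=\{\theta\in\mathrm{Der}(S):\theta(\alpha_H)\in\alpha_HS\ \forall H\}$ is free over $S=\mathbb{R}[x_1,\dots,x_n]$, exponents being degrees of a homogeneous basis. $\mathcal{A}$ is flag-accurate if it is free with exponents $e_1\le\dots\le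 e_n$ and there is a flag $X_1\subseteq\dots\subseteq X_n=W$ in $L(\mathcal{A})$ with $\dim X_d=d$ and $\mathcal{A}^{X_d}$ free with exponents $(e_1,\dots,e_d)$ for all $d$. *)

(* Defs.v *)
From HB Require Import structures.
From mathcomp Require Import all_boot all_order all_algebra.
From mathcomp Require Import reals.
From mathcomp Require Import mpoly.

Set Implicit Arguments.
Unset Strict Implicit.
Unset Printing Implicit Defensive.

Import GRing.Theory.
Local Open Scope ring_scope.

(* A central arrangement in V is the list of its hyperplanes, seen as
   subspaces; order and repetitions are irrelevant to all notions below. *)
Definition arrangement (R : realType) (V : vectType R) := seq {vspace V}.

Definition in_lattice (R : realType) (V : vectType R)
    (A : arrangement V) (X : {vspace V}) : Prop :=
  exists2 B : seq {vspace V},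
    {subset B <= A} & X = (\bigcap_(H <- B) H)%VS.

(* A^X is an arrangement in the vector space X, i.e. in [subvs_of X]. *)
Definition restriction (R : realType) (V : vectType R)
    (A : arrangement V) (X : {vspace V}) : arrangement (subvs_of X) :=
  [seq (linfun (@vsval R V X) @^-1: H)%VS | H <- A & ~~ (X <= H)%VS].

(* The algebra S = Sym(V^* ) of polynomial functions on V, in the coordinates
   given by the basis [vbasis {:V}]. *)
Definition polyfun (R : realType) (V : vectType R) := {mpoly R[\dim {:V}]}.

Definition form_poly (R : realType) (V : vectType R)
    (alpha : 'Hom(V, R^o)) : polyfun V :=
  \sum_(i < \dim {:V}) (alpha (tnth (vbasis {:V}) i) : R) *: 'X_i.

Definition is_derivation (R : realType) (V : vectType R)
    (theta : {linear polyfun V -> polyfun V}) : Prop :=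
  forall p q : polyfun V, theta (p * q) = theta p * q + p * theta q.

(* Membership in D(A); the defining form alpha_H of H is unique up to a nonzero
   scalar, hence the quantification over all forms with kernel H. *)
Definition in_D (R : realType) (V : vectType R) (A : arrangement V)
    (theta : {linear polyfun V -> polyfun V}) : Prop :=
  is_derivation theta /\
  forall (H : {vspace V}) (alpha : 'Hom(V, R^o)), H \in A -> lker alpha = H ->
    exists q : polyfun V, theta (form_poly alpha) = form_poly alpha * q.

(* Polynomial degree: sum_i f_i d/dx_i has degree d when all the f_i do. *)
Definition homogeneous_der (R : realType) (V : vectType R) (d : nat)
    (theta : {linear polyfun V -> polyfun V}) : Prop :=
  forall i : 'I_(\dim {:V}), theta 'X_i \is d.-homog.

(* D(A) has a homogeneous S-basis whose degrees are listed by e. *)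
Definition free_with_exponents (R : realType) (V : vectType R)
    (A : arrangement V) (e : seq nat) : Prop :=
  exists theta : 'I_(size e) -> {linear polyfun V -> polyfun V},
    [/\ forall i : 'I_(size e), in_D A (theta i),
        forall i : 'I_(size e), homogeneous_der (nth 0%N e i) (theta i)
      & forall eta : {linear polyfun V -> polyfun V}, in_D A eta ->
          exists! c : {ffun 'I_(size e) -> polyfun V},
            forall p : polyfun V, eta p = \sum_i c i * theta i p].

Definition flag_accurate_with_exponents (R : realType) (V : vectType R)
    (A : arrangement V) (e : seq nat) : Prop :=
  [/\ size e = \dim {:V}, sorted leq e, free_with_exponents A e
    & exists X : nat -> {vspace V},
        [/\ X (\dim {:V}) = fullv,
            forall d, (0 < d < \dim {:V})%N -> (X d <= X d.+1)%VS
          & forall d, (0 < d <= \dim {:V})%N ->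
              [/\ in_lattice A (X d), \dim (X d) = d
                & free_with_exponents (restriction A (X d)) (take d e)]]].

Definition flag_accurate (R : realType) (V : vectType R)
    (A : arrangement V) : Prop :=
  exists e : seq nat, flag_accurate_with_exponents A e.

(* An affine arrangement in R^l is given by the equations of its hyperplanes:
   the pair (u, d) stands for u_1 x_1 + ... + u_l x_l = d. *)
Definition affine_arrangement (R : realType) (l : nat) := seq ('rV[R]_l * R).

Definition kernel_of (R : realType) (n : nat) (w : 'rV[R]_n) :
    {vspace 'rV[R]_n} :=
  lker (linfun (fun x : 'rV[R]_n => \sum_j w 0 j * x 0 j : R^o)).

(* The last coordinate of R^(l + 1) is the extra coordinate z. *)
Definition cone (R : realType) (l : nat) (A : affine_arrangement R l) :
    arrangement 'rV[R]_(l + 1) :=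
  kernel_of (row_mx 0 1%:M)
    :: [seq kernel_of (row_mx h.1 (- h.2)%:M) | h <- A].

Definition coord_form (R : realType) (l : nat) (i : 'I_l) : 'rV[R]_l :=
  delta_mx 0 i.

Definition roots_short (R : realType) (l : nat) : seq 'rV[R]_l :=
  [seq coord_form R p.1 + coord_form R p.2
     | p : 'I_l * 'I_l <- enum {: 'I_l * 'I_l} & (p.1 < p.2)%N] ++
  [seq coord_form R p.1 - coord_form R p.2
     | p : 'I_l * 'I_l <- enum {: 'I_l * 'I_l} & (p.1 < p.2)%N].

Definition roots_long (R : realType) (l : nat) : seq 'rV[R]_l :=
  [seq 2 *: coord_form R i | i : 'I_l].

(* The integers s with - k <= s <= k. *)
Definition int_range (k : nat) : seq int :=
  [seq j%:Z - k%:Z | j <- iota 0 (2 * k).+1].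

Definition deformation (R : realType) (l : nat) (forms : seq 'rV[R]_l)
    (k : nat) : affine_arrangement R l :=
  [seq (u, s%:~R) | u <- forms, s <- int_range k].

Definition C0 (R : realType) (l m a : nat) : affine_arrangement R l :=
  deformation (roots_short R l) a ++ deformation (roots_long R l) m.

(* The hyperplanes alpha = s, for alpha a positive root of type C_l and
   - m <= s <= m. *)
Definition CatC (R : realType) (l m : nat) : affine_arrangement R l :=
  deformation (roots_short R l ++ roots_long R l) m.

(* Main.v *)
Require Import Defs.
From HB Require Import structures.
From mathcomp Require Import all_boot all_order all_algebra.
From mathcomp Require Import reals.
From mathcomp Require Import ring lra zify.
From mathcomp Require Import mpoly.

(* Put v_i = 2 x_i. Restricting the cone to 2 x_l = m z, x_(l-1) - x_l = a z,
   x_(l-2) - x_(l-1) = a z, ... leads to arrangements of the same kind, namely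
   z = 0, v_i +- v_j = 2 s z (|s| <= a) and v_i = c z, where c ranges over two
   centred arithmetic progressions of step 2, with r1 and r2 terms and r1 + r2
   odd. So only their freeness is needed, and Saito's criterion reduces it to
   exhibiting independent derivations of the right degrees.
   For a polynomial f(u), even in u, that solves the difference equation
     (u + A z)(u + B z) f(u + z) - (u - A z)(u - B z) f(u - z)
       = z u u^(2k) prod_(j, c) (u^2 - (v_j + c z)^2)
   with A = r1 - a, B = r2 - a and c in the centred progression with a terms,
   let Phi(u) = [u]_A [u]_B f(u), where [u]_n is the product of the u - c z over
   the centred progression with n terms, and [u]_(-n) = 1 / [u]_n. The right-hand
   side vanishes at u = v_i + c z, so that Phi(v_i + b z) does not depend on b in
   the centred progression with a + 1 terms: this common value theta_i is a
   polynomial, Phi is odd, and moving b along its progression makes all the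
   divisibility conditions on sum_i theta_i d/dv_i visible. *)

Set Implicit Arguments.
Unset Strict Implicit.
Unset Printing Implicit Defensive.

Import Order.TTheory GRing.Theory Num.Theory.
Local Open Scope ring_scope.

(** * Divisibility by linear forms *)

Section Divides.
Variable S : comNzRingType.
Implicit Types p q r : S.

Definition divides p q := exists r, q = p * r.

Lemma divides_refl p : divides p p.
Proof. by exists 1; rewrite mulr1. Qed.

Lemma divides0 p : divides p 0.
Proof. by exists 0; rewrite mulr0. Qed.

Lemma dividesD p q r : divides p q -> divides p r -> divides p (q + r).
Proof. by move=> [x ->] [y ->]; exists (x + y); rewrite mulrDr. Qed.

Lemma dividesN p q : divides p q -> divides p (- q).
Proof. by move=> [x ->]; exists (- x); rewrite mulrN. Qed.

Lemma dividesB p q r : divides p q -> divides p r -> divides p (q - r).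
Proof. by move=> pq pr; apply/dividesD/dividesN. Qed.

Lemma divides_mulr p q r : divides p q -> divides p (q * r).
Proof. by move=> [x ->]; exists (x * r); rewrite mulrA. Qed.

Lemma divides_mull p q r : divides p q -> divides p (r * q).
Proof. by rewrite mulrC; apply: divides_mulr. Qed.

Lemma divides_sum I (s : seq I) p (f : I -> S) :
  (forall i, divides p (f i)) -> divides p (\sum_(i <- s) f i).
Proof.
by move=> pf; apply: big_ind => //; [apply: divides0 | apply: dividesD].
Qed.

Lemma divides_horner p (f : {poly S}) x y :
  divides p (x - y) -> divides p (f.[x] - f.[y]).
Proof.
move=> pxy; rewrite !horner_coef -sumrB; apply: divides_sum => i.
by rewrite -mulrBr subrXX; apply/divides_mull/divides_mulr.
Qed.

End Divides.

(** * Linear forms as prime elements, and homogeneous factors *)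

Section LinearForms.
Variables (F : fieldType) (N : nat).
Local Notation P := {mpoly F[N]}.
Implicit Types (w : 'rV[F]_N) (p q : P).

Definition lform w : P := \sum_i w 0 i *: 'X_i.

Lemma lform_is_linear : linear lform.
Proof.
move=> c u w; rewrite /lform scaler_sumr -big_split /=; apply: eq_bigr => i _.
by rewrite !mxE scalerDl scalerA.
Qed.

HB.instance Definition _ := GRing.isLinear.Build F 'rV[F]_N P _ lform
  lform_is_linear.

Lemma lform_coef w i : (lform w)@_U_(i) = w 0 i.
Proof.
rewrite /lform raddf_sum /= (bigD1 i) //= mcoeffZ mcoeffXU eqxx mulr1.
by rewrite big1 ?addr0 // => j /negPf ji; rewrite mcoeffZ mcoeffXU ji mulr0.
Qed.

Lemma lform_inj : injective lform.
Proof. by move=> u w uw; apply/rowP => i; rewrite -!lform_coef uw. Qed.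

Lemma lform_eq0 w : (lform w == 0) = (w == 0).
Proof. by rewrite -(inj_eq lform_inj) linear0. Qed.

Lemma lform_homog w : lform w \is 1.-homog.
Proof.
by apply: rpred_sum => i _; apply: rpredZ; rewrite dhomogX /= mdeg1.
Qed.

(* The substitution that solves [lform w = 0] for the variable of index j. *)
Definition elim_var w (j : 'I_N) : P -> P :=
  comp_mpoly [tuple 'X_i - ((i == j)%:R / w 0 j) *: lform w | i < N].

HB.instance Definition _ w j := GRing.RMorphism.on (elim_var w j).
HB.instance Definition _ w j := GRing.Linear.on (elim_var w j).

Lemma elim_varX w j i :
  elim_var w j 'X_i = 'X_i - ((i == j)%:R / w 0 j) *: lform w.
Proof. by rewrite /elim_var comp_mpolyXU nth_mktuple. Qed.

Lemma elim_var_lform w j u : elim_var w j (lform u) =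
  lform (u - (u 0 j / w 0 j) *: w).
Proof.
rewrite linearB linearZ /= {1}/lform linear_sum /=.
transitivity (lform u - \sum_i (u 0 i * ((i == j)%:R / w 0 j)) *: lform w).
  rewrite /lform -sumrB; apply: eq_bigr => i _.
  by rewrite linearZ /= elim_varX scalerBr scalerA.
congr (_ - _); rewrite (bigD1 j) //= eqxx mul1r big1 ?addr0 // => i /negPf->.
by rewrite mul0r mulr0 scale0r.
Qed.

Lemma elim_var_self w j : w 0 j != 0 -> elim_var w j (lform w) = 0.
Proof.
by move=> wj; rewrite elim_var_lform divff // scale1r subrr linear0.
Qed.

(** The substitution changes each variable by a multiple of the form, and congruence modulo the form
    is stable under sums and products. *)
Lemma elim_var_congr w j p : divides (lform w) (p - elim_var w j p).
Proof.
elim/mpolyind: p => [|c m p _ _ IHp]; first by rewrite linear0 subrr; apply: divides0.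
rewrite linearD opprD addrACA; apply: dividesD => //.
rewrite linearZ -scalerBr -mul_mpolyC; apply: divides_mull.
rewrite mpolyXE_id rmorph_prod /=.
apply: (big_ind2 (fun x y => divides (lform w) (x - y))).
- by rewrite subrr; apply: divides0.
- move=> x1 x2 y1 y2 h1 h2.
  have -> : x1 * y1 - x2 * y2 = x1 * (y1 - y2) + (x1 - x2) * y2 by ring.
  by apply: dividesD; [apply: divides_mull | apply: divides_mulr].
- move=> i _; rewrite rmorphXn /= subrXX; apply: divides_mulr.
  rewrite elim_varX opprB addrC subrK -mul_mpolyC.
  exact/divides_mull/divides_refl.
Qed.

Lemma lform_dividesP w j p :
  w 0 j != 0 -> divides (lform w) p <-> elim_var w j p = 0.
Proof.
move=> wj; split=> [[q ->]|p0]; first by rewrite rmorphM /= elim_var_self ?mul0r.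
by have := elim_var_congr w j p; rewrite p0 subr0.
Qed.

Lemma row_neq0 w : w != 0 -> exists j, w 0 j != 0.
Proof. by move=> /rV0Pn. Qed.

(** The kernel of the ring morphism [elim_var w j] is the ideal of the form, and its target is a
    domain. *)
Lemma lform_prime w p q : w != 0 -> divides (lform w) (p * q) ->
  divides (lform w) p \/ divides (lform w) q.
Proof.
move=> /row_neq0[j wj] /(lform_dividesP _ wj).
rewrite rmorphM => /eqP; rewrite mulf_eq0 => /orP[] /eqP pq0; [left|right];
  exact/(lform_dividesP _ wj).
Qed.

Lemma lform_divides_lform w u :
  w != 0 -> divides (lform w) (lform u) -> exists c, u = c *: w.
Proof.
move=> /row_neq0[j wj] /(lform_dividesP _ wj); rewrite elim_var_lform.
move/eqP; rewrite lform_eq0 subr_eq0 => /eqP->.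
by exists (u 0 j / w 0 j).
Qed.

Lemma mcoeff_pihomog d p m :
  (pihomog mdeg d p)@_m = if mdeg m == d then p@_m else 0.
Proof.
elim/mpolyind: p => [|c k p _ _ IHp]; first by rewrite pihomog0 mcoeff0 if_same.
rewrite linearD linearZ /= pihomogX !mcoeffD !mcoeffZ IHp.
have [->|/negPf km] := eqVneq k m.
  by case: ifP => _; rewrite ?mcoeff0 ?mulr0 ?add0r.
by rewrite (fun_if (fun x => x@_m)) mcoeffX km mcoeff0 if_same mulr0 !add0r.
Qed.

(** Let r be [q] minus its component of degree e. If r were nonzero, its leading monomial would have
    a degree other than e, while the leading monomial of [p * r] has degree d + e. *)
Lemma dhomog_factor d e p q : p != 0 -> p \is d.-homog ->
  p * q \is (d + e).-homog -> q \is e.-homog.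
Proof.
move=> p0 hp hpq; pose r := q - pihomog mdeg e q.
have hpr : p * r \is (d + e).-homog.
  by rewrite mulrBr; apply: rpredB => //; apply: dhomogM => //; apply: pihomogP.
have [r0|r0] := eqVneq r 0.
  by move/eqP: r0; rewrite subr_eq0 => /eqP->; apply: pihomogP.
have := mlead_supp r0; rewrite mcoeff_msupp mcoeffB mcoeff_pihomog.
case: (eqVneq (mdeg (mlead r)) e) => [_|re _]; first by rewrite subrr eqxx.
have pr0 : p * r != 0 by rewrite mulf_neq0.
have := dhomogP _ _ _ hpr _ (mlead_supp pr0).
rewrite mleadM // => /eqP.
rewrite /= mdegD (dhomogP _ _ _ hp _ (mlead_supp p0)) eqn_add2l.
by rewrite (negPf re).
Qed.

Lemma dhomog0_const p : p \is 0.-homog -> p = (p@_0)%:MP.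
Proof.
move=> hp; apply/mpolyP => m; rewrite mcoeffC.
have [->|m0] := eqVneq m 0%MM; first by rewrite mulr1.
rewrite mulr0; apply: (dhomog_nemf_coeff hp).
by rewrite mdeg_eq0.
Qed.

Lemma dhomog_prod_seq (I : eqType) (s : seq I) (f : I -> P) (d : I -> nat) :
  {in s, forall i, f i \is (d i).-homog} ->
  \prod_(i <- s) f i \is (\sum_(i <- s) d i)%N.-homog.
Proof.
elim: s => [|i s IHs] fs; first by rewrite !big_nil dhomog1.
rewrite !big_cons; apply: dhomogM; first by apply: fs; rewrite mem_head.
by apply: IHs => j js; apply: fs; rewrite in_cons js orbT.
Qed.

Lemma dhomog_det n (T : 'M[P]_n) (e : 'I_n -> nat) :
  (forall i j, T i j \is (e i).-homog) -> \det T \is (\sum_i e i)%N.-homog.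
Proof.
move=> hT; apply: rpred_sum => s _; rewrite mulr_sign.
by case: ifP => _; rewrite ?rpredN; apply: dhomog_prod_seq => i _; apply: hT.
Qed.

End LinearForms.

(** * The difference equation *)

Section DifferenceEquation.
Variables (F : numFieldType) (N : nat).
Local Notation P := {mpoly F[N]}.
Variables (z : P) (A B : int).
Hypothesis z_homog : z \is 1.-homog.
Hypothesis odd_AB : odd `|A + B|.

(** Homogeneity of degree D in u and the variables together is expressed through the values of [f]
    at forms of degree 1. Here [g] is the right-hand side of the difference equation. *)
Definition even_solution (g : P -> P) (D : nat) (f : {poly P}) :=
  [/\ (size f <= D.+1)%N,
      forall u, f.[- u] = f.[u],
      forall u, u \is 1.-homog -> f.[u] \is D.-homog
    & forall u, (u + A%:~R * z) * (u + B%:~R * z) * f.[u + z]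
                - (u - A%:~R * z) * (u - B%:~R * z) * f.[u - z] = g u].

Lemma even_solutionD g1 g2 D f1 f2 : even_solution g1 D f1 ->
  even_solution g2 D f2 -> even_solution (fun u => g1 u + g2 u) D (f1 + f2).
Proof.
move=> [s1 e1 h1 t1] [s2 e2 h2 t2]; split.
- by rewrite (leq_trans (size_polyD _ _)) // geq_max s1.
- by move=> u; rewrite !hornerD e1 e2.
- by move=> u hu; rewrite hornerD rpredD ?h1 ?h2.
- by move=> u; rewrite -t1 -t2 !hornerD; ring.
Qed.

Lemma even_solutionM g D f d c : c \is d.-homog -> even_solution g D f ->
  even_solution (fun u => c * g u) (d + D) (c *: f).
Proof.
move=> hc [s e h t]; split.
- by rewrite (leq_trans (size_scale_leq _ _)) // (leq_trans s) // ltnS leq_addl.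
- by move=> u; rewrite !hornerZ e.
- by move=> u hu; rewrite hornerZ dhomogM ?h.
- by move=> u; rewrite -t !hornerZ; ring.
Qed.

Lemma even_solution_ext g1 g2 D f :
  g1 =1 g2 -> even_solution g1 D f -> even_solution g2 D f.
Proof. by move=> g12 [s e h t]; split=> // u; rewrite -g12. Qed.

(** In bracket notation this is [u]_(2r), with roots the odd multiples of z from -(2r - 1) to 2r -
    1, and [even_nodes] is [u]_(2r+1). *)
Definition odd_nodes r : {poly P} :=
  \prod_(j < r) ('X^2 - (((2 * j + 1)%:R * z) ^+ 2)%:P).

Definition even_nodes r u : P :=
  u * \prod_(j < r) (u ^+ 2 - ((2 * j.+1)%:R * z) ^+ 2).

Lemma odd_nodesS r u : (odd_nodes r.+1).[u] =
  (odd_nodes r).[u] * (u ^+ 2 - ((2 * r + 1)%:R * z) ^+ 2).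
Proof. by rewrite /odd_nodes big_ord_recr hornerM !hornerE. Qed.

Lemma even_nodesS r u : even_nodes r.+1 u =
  even_nodes r u * (u ^+ 2 - ((2 * r.+1)%:R * z) ^+ 2).
Proof. by rewrite /even_nodes big_ord_recr mulrA. Qed.

Lemma odd_nodes_even r u : (odd_nodes r).[- u] = (odd_nodes r).[u].
Proof.
by rewrite /odd_nodes !horner_prod; apply: eq_bigr => j _; rewrite !hornerE sqrrN.
Qed.

(** Shifting by z moves the odd nodes to the even ones; just the node -2 (r + 1) is left without its
    mirror image. *)
Lemma odd_nodes_shift r u :
  (odd_nodes r.+1).[u + z] = even_nodes r u * (u + (2 * r.+1)%:R * z).
Proof.
elim: r => [|r IHr].
  by rewrite /even_nodes odd_nodesS /odd_nodes !big_ord0 !hornerE; ring.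
by rewrite odd_nodesS IHr even_nodesS !natrM !natrD; ring.
Qed.

Lemma odd_nodes_shiftN r u :
  (odd_nodes r.+1).[u - z] = even_nodes r u * (u - (2 * r.+1)%:R * z).
Proof.
rewrite -odd_nodes_even opprB addrC odd_nodes_shift.
have -> : even_nodes r (- u) = - even_nodes r u.
  by rewrite /even_nodes mulNr; congr (- (u * _)); apply: eq_bigr => j _; rewrite sqrrN.
by ring.
Qed.

Lemma size_odd_nodes r : (size (odd_nodes r) <= (2 * r).+1)%N.
Proof.
rewrite /odd_nodes; elim: r => [|r IHr]; first by rewrite big_ord0 size_poly1.
rewrite big_ord_recr /= (leq_trans (size_polyMleq _ _)) //.
by rewrite size_XnsubC // addn3 mulnS /= !ltnS.
Qed.

Lemma natz_homog k : k%:R * z \is 1.-homog.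
Proof. by rewrite -mpolyC_nat mul_mpolyC rpredZ. Qed.

Lemma intz_homog k : k%:~R * z \is 1.-homog.
Proof. by rewrite -(rmorph_int (@mpolyC N F)) mul_mpolyC rpredZ. Qed.

Lemma sqr_homog (u : P) : u \is 1.-homog -> u ^+ 2 \is 2.-homog.
Proof. exact: (@dhomogMn _ _ _ _ _ 2). Qed.

Lemma odd_nodes_homog r u : u \is 1.-homog -> (odd_nodes r).[u] \is (2 * r).-homog.
Proof.
move=> hu; have -> : (2 * r = \sum_(j < r) 2)%N by rewrite sum_nat_const card_ord mulnC.
rewrite /odd_nodes horner_prod; apply: dhomog_prod_seq => j _.
by rewrite !hornerE rpredB // sqr_homog // natz_homog.
Qed.

Lemma leading_neq0 r : A%:~R + B%:~R + r.*2%:R != 0 :> F.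
Proof.
rewrite -[_%:R]/(r.*2%:Z%:~R) -!intrD intr_eq0; apply/negP => /eqP ABr.
by move: odd_AB; lia.
Qed.

(* The difference operator sends [odd_nodes r.+1] to a combination of
   [z * even_nodes r.+1] and [z ^+ 3 * even_nodes r]; the leading coefficient
   2 (A + B + 2 (r + 1)) is nonzero because A + B is odd. *)
Lemma even_solution_node r :
  exists f, even_solution (fun u => z * even_nodes r u) (2 * r) f.
Proof.
have hC (c : F) : (c%:MP : P) \is 0.-homog.
  by rewrite -[c%:MP]mulr1 mul_mpolyC; apply: rpredZ; apply: dhomog1.
elim: r => [|r [f hf]].
  pose k : F := (2 * (A%:~R + B%:~R + 0.*2%:R))^-1.
  have kE : k%:MP * (2 * (A%:~R + B%:~R)) = 1 :> P.
    rewrite -!(rmorph_int (@mpolyC N F)) -mpolyC_nat -mpolyCD -!mpolyCM.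
    rewrite /k addr0 mulVf // mulf_neq0 ?pnatr_eq0 //.
    by have := leading_neq0 0; rewrite addr0.
  exists (k%:MP)%:P; split.
  - exact: size_polyC_leq1.
  - by move=> u; rewrite !hornerC.
  - by move=> u _; rewrite hornerC.
  - move=> u; rewrite !hornerC /even_nodes big_ord0.
    transitivity (k%:MP * (2 * (A%:~R + B%:~R)) * (z * u)); first by ring.
    by rewrite kE mul1r mulr1.
pose k : F := (2 * (A%:~R + B%:~R + r.+1.*2%:R))^-1.
have kE : k%:MP * (2 * (A%:~R + B%:~R + (2 * r.+1)%:R)) = 1 :> P.
  rewrite -!(rmorph_int (@mpolyC N F)) -!mpolyC_nat -!mpolyCD -!mpolyCM.
  by rewrite /k mul2n mulVf // mulf_neq0 ?pnatr_eq0 // leading_neq0.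
(* With n = 2 (r + 1), the image of [odd_nodes r.+1] exceeds 2 (A + B + n) z [even_nodes r.+1] by 2
   n (n + A) (n + B) z^3 [even_nodes r]; adding c z^2 [f] cancels the excess. *)
pose c : F := - (2 * (2 * r.+1)%:R * ((2 * r.+1)%:R + A%:~R) * ((2 * r.+1)%:R + B%:~R)).
have hb : even_solution
    (fun u => z * (2 * (A%:~R + B%:~R + (2 * r.+1)%:R)) * even_nodes r.+1 u
      - c%:MP * z ^+ 2 * (z * even_nodes r u)) (2 * r.+1) (odd_nodes r.+1).
  split; [exact: size_odd_nodes | exact: odd_nodes_even | exact: odd_nodes_homog |].
  move=> u; rewrite odd_nodes_shift odd_nodes_shiftN even_nodesS.
  rewrite /c !(mpolyCN, mpolyCM, mpolyCD, mpolyC_nat, rmorph_int (@mpolyC N F)).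
  by ring.
have hcz : c%:MP * z ^+ 2 \is 2.-homog.
  by rewrite mul_mpolyC rpredZ // sqr_homog.
have hcf := even_solutionM hcz hf; rewrite -mulnS in hcf.
have := even_solutionM (hC k) (even_solutionD hb hcf).
rewrite add0n => /(even_solution_ext (g2 := fun u => z * even_nodes r.+1 u)) h.
eexists; apply: h => u; rewrite subrK.
transitivity (k%:MP * (2 * (A%:~R + B%:~R + (2 * r.+1)%:R)) * (z * even_nodes r.+1 u)).
  by ring.
by rewrite kE mul1r.
Qed.

(** With n = 2 (r + 1), writing u^2 - y as (u^2 - (n z)^2) + ((n z)^2 - y) either turns
    [even_nodes r] into [even_nodes r.+1] or pulls out a factor free of u. By linearity the factors
    are removed one by one; this is why the claim is proved for all r. *)
Lemma even_solution_exists (ys : seq P) : {in ys, forall y, y \is 2.-homog} ->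
  exists f, even_solution (fun u => z * u * \prod_(y <- ys) (u ^+ 2 - y))
                          (2 * size ys) f.
Proof.
move=> hys; suff H r : exists f, even_solution
    (fun u => z * even_nodes r u * \prod_(y <- ys) (u ^+ 2 - y))
    (2 * (r + size ys)) f.
  have [f hf] := H 0%N; exists f; apply: even_solution_ext hf => u.
  by rewrite /even_nodes big_ord0 mulr1.
elim: ys hys r => [|y ys IHys] hys r.
  have [f hf] := even_solution_node r; exists f; rewrite addn0.
  by apply: even_solution_ext hf => u; rewrite big_nil mulr1.
have hys' : {in ys, forall y, y \is 2.-homog}.
  by move=> x xs; apply: hys; rewrite in_cons xs orbT.
have [[f1 h1] [f2 h2]] := (IHys hys' r.+1, IHys hys' r).
have hc : ((2 * r.+1)%:R * z) ^+ 2 - y \is 2.-homog.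
  by rewrite rpredB ?sqr_homog ?natz_homog ?hys ?mem_head.
exists (f1 + (((2 * r.+1)%:R * z) ^+ 2 - y) *: f2).
have := even_solutionM hc h2.
have -> : (2 + 2 * (r + size ys) = 2 * (r.+1 + size ys))%N by lia.
move=> /(even_solutionD h1); rewrite /= addSnnS.
apply: even_solution_ext => u; rewrite big_cons even_nodesS; ring.
Qed.

End DifferenceEquation.

(** * Linear forms in given coordinates *)

Definition sym_range (k : nat) : seq int :=
  [seq (2 * t)%:Z - k%:Z + 1 | t <- iota 0 k].

Lemma mem_sym_range k (c : int) :
  (c \in sym_range k) = (`|c| < k)%N && odd (`|c| + k).
Proof.
apply/mapP/idP => [[t]|].
  rewrite mem_iota => /andP[_ tk] ->.
  by apply/andP; split; lia.
move=> /andP[ck oddck]; exists (absz (c + k%:Z - 1)%R)./2.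
  by rewrite mem_iota; lia.
by lia.
Qed.

Lemma sym_range_uniq k : uniq (sym_range k).
Proof. by rewrite map_inj_uniq ?iota_uniq // => x y; lia. Qed.

Lemma size_sym_range k : size (sym_range k) = k.
Proof. by rewrite size_map size_iota. Qed.

Section Forms.
Variables (F : numFieldType) (N d : nat) (U : 'M[F]_(1 + d, N)).
Hypothesis U_free : row_free U.
Local Notation P := {mpoly F[N]}.
Implicit Types (w : 'rV[F]_(1 + d)) (i j : 'I_d) (c : int).

(** The rows of [U] are the coefficients of z, v_1, ..., v_d, and [w] lists coordinates with respect
    to these forms. *)
Definition form w : P := lform (w *m U).

Lemma form_is_linear : linear form.
Proof. by move=> k u w; rewrite /form mulmxDl -scalemxAl linearP. Qed.

HB.instance Definition _ := GRing.isLinear.Build F 'rV[F]_(1 + d) P _ form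
  form_is_linear.

Lemma form_eq0 w : (form w == 0) = (w == 0).
Proof. by rewrite lform_eq0 mulmx_free_eq0. Qed.

Lemma form_homog w : form w \is 1.-homog.
Proof. exact: lform_homog. Qed.

Lemma form_prime w p q : w != 0 -> divides (form w) (p * q) ->
  divides (form w) p \/ divides (form w) q.
Proof. by move=> w0; apply: lform_prime; rewrite mulmx_free_eq0. Qed.

Lemma form_divides_form w u :
  w != 0 -> divides (form w) (form u) -> exists k, u = k *: w.
Proof.
move=> w0 /lform_divides_lform[]; first by rewrite mulmx_free_eq0.
move=> k /eqP; rewrite scalemxAl -subr_eq0 -mulmxBl mulmx_free_eq0 //.
by rewrite subr_eq0 => /eqP ->; exists k.
Qed.

Lemma form_prime_prod w (I : eqType) (s : seq I) (f : I -> P) : w != 0 ->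
  divides (form w) (\prod_(x <- s) f x) -> exists2 x, x \in s & divides (form w) (f x).
Proof.
move=> w0; elim: s => [|x s IHs].
  (* The empty product is 1, and a form of degree 1 does not divide it: compare the degrees of the
     leading monomials. *)
  rewrite big_nil => -[q E]; have fw0 : form w != 0 by rewrite form_eq0.
  have q0 : q != 0 by apply: contra_eq_neq E => ->; rewrite mulr0 oner_neq0.
  have := congr1 (fun p : P => mdeg (mlead p)) E; rewrite /= mleadM // mlead1 mdeg0 mdegD.
  by have /dhomogP -> := form_homog w; rewrite ?mlead_supp.
rewrite big_cons => /(form_prime w0)[wx|/IHs[y ys wy]].
  by exists x => //; rewrite mem_head.
by exists y => //; rewrite in_cons ys orbT.
Qed.

(** Repeated factors are allowed: each form is prime and does not divide [q], so it is cancelled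
    from [p] before the next one is treated. *)
Lemma form_prod_coprime (s : seq 'rV[F]_(1 + d)) p q :
  {in s, forall w, w != 0 /\ ~ divides (form w) q} ->
  divides (\prod_(w <- s) form w) (p * q) -> divides (\prod_(w <- s) form w) p.
Proof.
elim: s p => [|w s IHs] p hs; first by rewrite !big_nil; exists p; rewrite mul1r.
rewrite !big_cons => -[r E]; have [w0 wq] := hs w (mem_head w s).
have /(form_prime w0)[[p' pE]|//] : divides (form w) (p * q).
  by rewrite E -mulrA; apply/divides_mulr/divides_refl.
have /IHs[|r' p'E] : divides (\prod_(w <- s) form w) (p' * q).
- exists r; apply: (@mulfI _ (form w)); first by rewrite form_eq0.
  by rewrite mulrA -pE E mulrA.
- by move=> x xs; apply: hs; rewrite in_cons xs orbT.
by exists r'; rewrite pE p'E mulrA.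
Qed.

Definition zrow : 'rV[F]_(1 + d) := row_mx 1%:M 0.
Definition vrow i c : 'rV[F]_(1 + d) := row_mx c%:~R%:M (delta_mx 0 i).

Lemma zrow_l : zrow 0 (lshift d 0) = 1.
Proof. by rewrite row_mxEl mxE eqxx. Qed.
Lemma zrow_r j : zrow 0 (rshift 1 j) = 0.
Proof. by rewrite row_mxEr mxE. Qed.
Lemma vrow_l i c : vrow i c 0 (lshift d 0) = c%:~R.
Proof. by rewrite row_mxEl mxE eqxx. Qed.
Lemma vrow_r i c j : vrow i c 0 (rshift 1 j) = (i == j)%:R.
Proof. by rewrite row_mxEr mxE eqxx eq_sym. Qed.

Lemma zrow_neq0 : zrow != 0.
Proof.
by apply/eqP => /rowP/(_ (lshift d 0)) /eqP; rewrite zrow_l mxE oner_eq0.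
Qed.

Lemma vrow_neq0 i c : vrow i c != 0.
Proof.
by apply/eqP => /rowP/(_ (rshift 1 i)) /eqP; rewrite vrow_r eqxx mxE oner_eq0.
Qed.

Lemma vrowD i c b : vrow i c + b%:~R *: zrow = vrow i (c + b).
Proof.
rewrite /vrow /zrow scale_row_mx add_row_mx scaler0 addr0 scale_scalar_mx.
by rewrite mulr1 rmorphD raddfD.
Qed.

Local Notation z := (form zrow).
Local Notation v i c := (form (vrow i c)).

Lemma z_neq0 : z != 0.
Proof. by rewrite form_eq0 zrow_neq0. Qed.

Lemma v_neq0 i c : v i c != 0.
Proof. by rewrite form_eq0 vrow_neq0. Qed.

Lemma mul_intz (b : int) (p : P) : b%:~R * p = (b%:~R : F) *: p.
Proof. by rewrite -mul_mpolyC rmorph_int. Qed.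

Lemma v_shift i c (b : int) : v i c + b%:~R * z = v i (c + b).
Proof. by rewrite mul_intz -vrowD linearD linearZ. Qed.

Lemma v_shiftN i c (b : int) : v i c - b%:~R * z = v i (c - b).
Proof. by rewrite -mulNr -rmorphN v_shift. Qed.

Lemma v_shift1 i c : v i c + z = v i (c + 1).
Proof. by rewrite -v_shift mul1r. Qed.

Lemma v_shiftN1 i c : v i c - z = v i (c - 1).
Proof. by rewrite -v_shiftN mul1r. Qed.

Lemma v_divides i c b : divides (v i c) (v i b) -> b = c.
Proof.
move=> /(form_divides_form (vrow_neq0 i c))[k E].
have := congr1 (fun w => w 0 (rshift 1 i)) E; rewrite [RHS]mxE !vrow_r eqxx mulr1 => k1.
have := congr1 (fun w => w 0 (lshift d 0)) E; rewrite [RHS]mxE !vrow_l -k1 mul1r.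
by move/intr_inj.
Qed.

Lemma v_not_divides w i j c :
  j != i -> w 0 (rshift 1 j) != 0 -> ~ divides (form w) (v i c).
Proof.
move=> ji wj; have w0 : w != 0 by apply: contra_neq wj => ->; rewrite mxE.
move=> /(form_divides_form w0)[k E].
have /esym/eqP := congr1 (fun w => w 0 (rshift 1 j)) E.
rewrite [X in X == _]mxE vrow_r [i == j]eq_sym (negPf ji) mulf_eq0 (negPf wj) orbF => /eqP k0.
move: E; rewrite k0 scale0r => /eqP; exact/negP/vrow_neq0.
Qed.

Lemma v_inj i j c b : v i c = v j b -> i = j /\ c = b.
Proof.
move=> /eqP; rewrite -subr_eq0 -linearB form_eq0 subr_eq0 => /eqP E.
have := congr1 (fun w => w 0 (rshift 1 i)) E; rewrite !vrow_r eqxx.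
have [->|_ /eqP] := eqVneq j i; last by rewrite oner_eq0.
have := congr1 (fun w => w 0 (lshift d 0)) E; rewrite !vrow_l.
by move/intr_inj.
Qed.

Lemma v_oppr_neq i j c b : v i c != - v j b.
Proof.
rewrite -subr_eq0 opprK -linearD form_eq0; apply/eqP => /rowP/(_ (rshift 1 i)).
rewrite [LHS]mxE [RHS]mxE !vrow_r eqxx.
by move/eqP; rewrite -mulrS pnatr_eq0.
Qed.

End Forms.

(** * Components of the basic derivations *)

(** The equations stand for equalities between the fractions x_i / y_i, without leaving the ring. *)
Lemma cross_trans (S : idomainType) (x0 x1 x2 y0 y1 y2 : S) :
  y1 != 0 -> x1 * y0 = x0 * y1 -> x2 * y1 = x1 * y2 -> x2 * y0 = x0 * y2.
Proof.
move=> y10 E1 E2; apply: (mulfI y10).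
transitivity (x2 * y1 * y0); first by ring.
rewrite E2; transitivity (x1 * y0 * y2); first by ring.
by rewrite E1; ring.
Qed.

Lemma cross_div (S : idomainType) (x0 x1 y0 y1 t : S) :
  y0 != 0 -> x0 = y0 * t -> x1 * y0 = x0 * y1 -> y1 * t = x1.
Proof.
by move=> y00 -> E; apply: (mulfI y00); rewrite [RHS]mulrC E; ring.
Qed.

(** * Brackets: products over centred progressions *)

Section RootPoly.
Variables (F : numFieldType) (N : nat).
Local Notation P := {mpoly F[N]}.
Variable z : P.
Implicit Types (s : seq int) (u : P).

Definition root_poly s : {poly P} := \prod_(c <- s) ('X - (c%:~R * z)%:P).

Lemma root_polyE s u : (root_poly s).[u] = \prod_(c <- s) (u - c%:~R * z).
Proof. by rewrite horner_prod; apply: eq_bigr => c _; rewrite hornerXsubC. Qed.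

Lemma root_poly_cat s1 s2 : root_poly (s1 ++ s2) = root_poly s1 * root_poly s2.
Proof. exact: big_cat. Qed.

Lemma root_poly_homog s u : z \is 1.-homog -> u \is 1.-homog ->
  (root_poly s).[u] \is (size s).-homog.
Proof.
move=> hz hu; rewrite root_polyE -sum1_size; apply: (dhomog_prod_seq (d := fun=> 1%N)) => c _.
by rewrite rpredB // intz_homog //.
Qed.

Lemma root_poly_symN k u : (root_poly (sym_range k)).[- u] =
  (-1) ^+ k * (root_poly (sym_range k)).[u].
Proof.
have symN : perm_eq (sym_range k) [seq - c | c <- sym_range k].
  apply: uniq_perm; rewrite ?(map_inj_uniq oppr_inj) ?sym_range_uniq //.
  move=> c; rewrite -[c in RHS]opprK (mem_map oppr_inj) !mem_sym_range.
  by rewrite abszN.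
rewrite root_polyE (perm_big _ symN) big_map -[in (-1) ^+ k](size_sym_range k).
rewrite root_polyE; elim: (sym_range k) => [|c s IHs]; first by rewrite !big_nil mulr1.
by rewrite /= !big_cons IHs exprS rmorphN; ring.
Qed.

Lemma root_poly_shift k u : (root_poly (sym_range k.+1)).[u + z] =
  (root_poly (sym_range k)).[u] * (u + k.+1%:Z%:~R * z).
Proof.
rewrite !root_polyE !big_map.
have -> : iota 0 k.+1 = 0%N :: map (addn 1) (iota 0 k) by rewrite -iotaDl.
rewrite big_cons big_map mulrC; congr (_ * _); last first.
  by rewrite muln0 -[k.+1%:Z]/(1 + k%:Z); ring.
apply: eq_bigr => t _.
have -> : (2 * (1 + t))%:Z - k.+1%:Z + 1 = ((2 * t)%:Z - k%:Z + 1) + 1 by lia.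
by rewrite rmorphD /=; ring.
Qed.

Lemma root_poly_shiftN k u : (root_poly (sym_range k.+1)).[u - z] =
  (root_poly (sym_range k)).[u] * (u - k.+1%:Z%:~R * z).
Proof.
have -> : u - z = - (- u + z) by ring.
rewrite root_poly_symN root_poly_shift root_poly_symN exprS.
set p := (root_poly _).[u]; set c := _%:~R.
transitivity ((-1) ^+ k * (-1) ^+ k * (p * (u - c * z))); first by ring.
by rewrite -expr2 sqrr_sign mul1r.
Qed.

(* The quotient of the two brackets below plays the role of [[u]_(r - a)]: it
   is a product over [sym_range (r - a)] when [a <= r] and the inverse of a
   product over [sym_range (a - r)] when [r <= a]. *)
Lemma root_poly_ratio r a u :
  (root_poly (sym_range (r - a))).[u + z] * (root_poly (sym_range (a - r))).[u - z]
    * (u - (r%:Z - a%:Z)%:~R * z) =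
  (root_poly (sym_range (r - a))).[u - z] * (root_poly (sym_range (a - r))).[u + z]
    * (u + (r%:Z - a%:Z)%:~R * z).
Proof.
have [ra|ar] := leqP r a.
- have -> : (r - a = 0)%N by lia.
  have -> : r%:Z - a%:Z = - (a - r)%N%:Z by lia.
  case: (a - r)%N => [|k]; first by rewrite !root_polyE !big_nil; ring.
  rewrite root_poly_shift root_poly_shiftN !root_polyE !big_nil rmorphN; ring.
- have -> : (a - r = 0)%N by lia.
  have -> : r%:Z - a%:Z = (r - a)%N%:Z by lia.
  case: (r - a)%N => [|k]; first by rewrite !root_polyE !big_nil; ring.
  rewrite root_poly_shift root_poly_shiftN !root_polyE !big_nil; ring.
Qed.

End RootPoly.

Section Basis.
Variables (F : numFieldType) (N d : nat) (U : 'M[F]_(1 + d, N)).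
Hypothesis U_free : row_free U.
Variables r1 r2 a : nat.
Local Notation P := {mpoly F[N]}.
Local Notation z := (form U (zrow F d)).
Local Notation v i c := (form U (vrow F i c)).

(** Phi is [num] divided by [den]. Subtraction on naturals is truncated, so a bracket [u]_(r - a)
    has its roots here when a <= r and its poles in [den_roots] when r <= a. *)
Definition num_roots := sym_range (r1 - a) ++ sym_range (r2 - a).
Definition den_roots := sym_range (a - r1) ++ sym_range (a - r2).
Definition den : {poly P} := root_poly z den_roots.

Lemma den_v i c : den.[v i c] = \prod_(x <- den_roots) v i (c - x).
Proof. by rewrite root_polyE; apply: eq_bigr => x _; rewrite v_shiftN. Qed.

Lemma den_v_neq0 i c : den.[v i c] != 0.
Proof. by rewrite den_v prodf_seq_neq0; apply/allP => x _; apply: v_neq0. Qed.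

Lemma den_v_divides w i c : w != 0 -> divides (form U w) den.[v i c] ->
  exists2 x, x \in den_roots & divides (form U w) (v i (c - x)).
Proof. by rewrite den_v => w0; apply: form_prime_prod. Qed.

Section OneField.
Variables (f : {poly P}) (D : nat) (ys : seq P).
Hypothesis f_sol : even_solution z (r1%:Z - a%:Z) (r2%:Z - a%:Z)
  (fun u => z * u * \prod_(y <- ys) (u ^+ 2 - y)) D f.
Hypothesis ys_v : forall i c, c \in sym_range a -> v i c ^+ 2 \in ys.

Definition num : {poly P} := root_poly z num_roots * f.

(** This is Phi(u + z) = Phi(u - z) at u = v_i + c z: there the right-hand side of the difference
    equation vanishes, and by [root_poly_ratio] the brackets absorb its four linear factors. *)
Lemma num_den_step i c : c \in sym_range a ->
  num.[v i (c + 1)] * den.[v i (c - 1)] = num.[v i (c - 1)] * den.[v i (c + 1)].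
Proof.
move=> ca; have [_ _ _ /(_ (v i c))] := f_sol.
rewrite (big_rem _ (ys_v i ca)) /= subrr mul0r mulr0 => /eqP; rewrite subr_eq0 => /eqP E.
have R1 := root_poly_ratio z r1 a (v i c).
have R2 := root_poly_ratio z r2 a (v i c).
have nz (r : nat) : v i c - (r%:Z - a%:Z)%:~R * z != 0 by rewrite v_shiftN v_neq0.
apply: (mulfI (nz r1)); apply: (mulfI (nz r2)).
rewrite -v_shift1 -v_shiftN1 /num /den /num_roots /den_roots !root_poly_cat !hornerM.
set c1 := _ * z in R1 *; set c2 := _ * z in R2 *; rewrite -/c1 -/c2 in E.
set u := v i c in E R1 R2 *.
set p1 := (root_poly z (sym_range (r1 - a))).[u + z] in R1 *.
set q1 := (root_poly z (sym_range (a - r1))).[u - z] in R1 *.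
set p2 := (root_poly z (sym_range (r2 - a))).[u + z] in R2 *.
set q2 := (root_poly z (sym_range (a - r2))).[u - z] in R2 *.
set p1' := (root_poly z (sym_range (r1 - a))).[u - z] in R1 *.
set q1' := (root_poly z (sym_range (a - r1))).[u + z] in R1 *.
set p2' := (root_poly z (sym_range (r2 - a))).[u - z] in R2 *.
set q2' := (root_poly z (sym_range (a - r2))).[u + z] in R2 *.
set fp := f.[u + z] in E *; set fm := f.[u - z] in E *.
transitivity ((p1 * q1 * (u - c1)) * (p2 * q2 * (u - c2)) * fp); first by ring.
rewrite R1 R2.
transitivity (p1' * q1' * (p2' * q2') * ((u + c1) * (u + c2) * fp)); first by ring.
by rewrite E; ring.
Qed.

Lemma num_den_chain i t : (t <= a)%N ->
  num.[v i (- a%:Z + (2 * t)%:Z)] * den.[v i (- a%:Z)] =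
  num.[v i (- a%:Z)] * den.[v i (- a%:Z + (2 * t)%:Z)].
Proof.
elim: t => [|t IHt] ta; first by rewrite muln0 addr0.
have /(num_den_step i) : - a%:Z + (2 * t)%:Z + 1 \in sym_range a.
  by rewrite mem_sym_range; apply/andP; split; lia.
have -> : - a%:Z + (2 * t)%:Z + 1 + 1 = - a%:Z + (2 * t.+1)%:Z by lia.
have -> : - a%:Z + (2 * t)%:Z + 1 - 1 = - a%:Z + (2 * t)%:Z by lia.
exact/cross_trans/(IHt (ltnW ta))/den_v_neq0.
Qed.

(** The fractions Phi(v_i - a z) and Phi(v_i + a z) agree, and their denominators have no common
    prime factor since every pole c z has |c| < a. Hence the first denominator divides its
    numerator, and the quotient serves for every b. *)
Lemma component_exists i : exists th : P,
  forall b, b \in sym_range a.+1 -> den.[v i b] * th = num.[v i b].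
Proof.
have [th E] : divides den.[v i (- a%:Z)] num.[v i (- a%:Z)].
  have -> : den.[v i (- a%:Z)] =
      \prod_(w <- [seq vrow F i (- a%:Z - x) | x <- den_roots]) form U w.
    by rewrite den_v big_map.
  have aE : - a%:Z + (2 * a)%:Z = a%:Z by lia.
  have := num_den_chain i (leqnn a); rewrite aE => chain.
  apply: (@form_prod_coprime _ _ _ _ U_free _ _ den.[v i a%:Z]); last first.
    rewrite big_map -den_v -chain mulrC.
    exact/divides_mulr/divides_refl.
  move=> _ /mapP[x xd ->]; split; first exact: vrow_neq0.
  move=> /(den_v_divides (vrow_neq0 _ _ _))[y yd].
  move=> /(v_divides U_free); move: xd yd; rewrite !mem_cat !mem_sym_range.
  by lia.
exists th => b /mapP[t]; rewrite mem_iota => /andP[_ ta] ->.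
have -> : (2 * t)%:Z - a.+1%:Z + 1 = - a%:Z + (2 * t)%:Z by lia.
exact: cross_div (den_v_neq0 i _) E (num_den_chain i ta).
Qed.

Lemma component_homog i b th e : (e + 2 * a = r1 + r2 + D)%N ->
  den.[v i b] * th = num.[v i b] -> th \is e.-homog.
Proof.
move=> he E; have [hz hv] := (form_homog U (zrow F d), form_homog U (vrow F i b)).
apply: (dhomog_factor (den_v_neq0 i b) (root_poly_homog den_roots hz hv)).
have [_ _ hf _] := f_sol.
have := dhomogM (root_poly_homog num_roots hz hv) (hf _ hv).
rewrite -hornerM -/num -E !size_cat !size_sym_range.
suff -> : (r1 - a + (r2 - a) + D = a - r1 + (a - r2) + e)%N by [].
by lia.
Qed.

Hypothesis odd_r : odd (r1 + r2).

(** [f] is even, and the product of the two brackets has the parity of r1 + r2 - 2 a, which is odd: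
    Phi is odd. *)
Lemma component_parity u th : den.[u] * th = num.[u] -> den.[- u] * - th = num.[- u].
Proof.
move=> E; have [_ fN _ _] := f_sol.
have denN : den.[- u] = (-1) ^+ (a - r1 + (a - r2)) * den.[u].
  rewrite /den root_poly_cat !hornerM !root_poly_symN exprD; ring.
have numN : num.[- u] = - (-1) ^+ (a - r1 + (a - r2)) * num.[u].
  have -> : - (-1) ^+ (a - r1 + (a - r2)) = (-1) ^+ (r1 - a + (r2 - a)) :> P.
    rewrite -mulN1r -exprS -signr_odd -[RHS]signr_odd; congr (_ ^+ nat_of_bool _).
    by lia.
  by rewrite /num root_poly_cat !hornerM !root_poly_symN fN exprD; ring.
by rewrite denN numN -E; ring.
Qed.

(** After multiplication by the value of [den] at u, which is prime to the form, the difference of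
    the two values of Phi becomes a combination of differences of polynomial values. *)
Lemma component_congr w u u' th th' : w != 0 -> ~ divides (form U w) den.[u] ->
  den.[u] * th = num.[u] -> den.[u'] * th' = num.[u'] ->
  divides (form U w) (u - u') -> divides (form U w) (th - th').
Proof.
move=> w0 wden E E' wu.
suff /(form_prime U_free w0)[] : divides (form U w) (den.[u] * (th - th')) by [].
have -> : den.[u] * (th - th') = (num.[u] - num.[u']) - (den.[u] - den.[u']) * th'.
  by rewrite -E -E'; ring.
by apply: dividesB; [|apply: divides_mulr]; apply: divides_horner.
Qed.

Lemma component_congrN w u u' th th' : w != 0 -> ~ divides (form U w) den.[u] ->
  den.[u] * th = num.[u] -> den.[u'] * th' = num.[u'] ->
  divides (form U w) (u + u') -> divides (form U w) (th + th').
Proof.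
move=> w0 wden E /component_parity E' wu; rewrite -[th']opprK.
by apply: (component_congr w0 wden E E'); rewrite opprK.
Qed.

Variable theta : 'I_d -> P.
Hypothesis thetaP : forall i b, b \in sym_range a.+1 ->
  den.[v i b] * theta i = num.[v i b].

Lemma not_divides_den (i j : 'I_d) (w : 'rV[F]_(1 + d)) b :
  j != i -> w 0 (rshift 1 j) != 0 -> ~ divides (form U w) den.[v i b].
Proof.
move=> ji wj; have w0 : w != 0 by apply: contra_neq wj => ->; rewrite mxE.
by move=> /(den_v_divides w0)[x _]; apply: (v_not_divides U_free ji wj).
Qed.

Lemma pair_row_r (i j : 'I_d) c (e : F) : j != i ->
  (vrow F i c + e *: vrow F j 0) 0 (rshift 1 j) = e.
Proof.
move=> ji; rewrite [LHS]mxE [X in _ + X]mxE !vrow_r eqxx mulr1.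
by rewrite eq_sym (negPf ji) add0r.
Qed.

(** The row stands for v_i - v_j - 2 s z. Modulo this form v_i + (b - 2 s) z equals v_j + b z, and
    Phi takes the values theta_i and theta_j there. *)
Lemma theta_sub i j (s : int) : j != i -> (`|s| <= a)%N ->
  divides (form U (vrow F i (- (2 * s)) + (-1) *: vrow F j 0)) (theta i - theta j).
Proof.
move=> ji sa; set w := _ + _.
have wj : w 0 (rshift 1 j) != 0 by rewrite pair_row_r // oppr_eq0 oner_eq0.
have w0 : w != 0 by apply: contra_neq wj => ->; rewrite mxE.
(* One of the two points is put at an end of the progression from -a to a; the other stays inside
   because |s| <= a. *)
have [b [ba b'a]] : exists b, - (2 * s) + b \in sym_range a.+1 /\ b \in sym_range a.+1.
  have [s0|s0] := lerP 0 s; [exists (2 * s - a%:Z) | exists (2 * s + a%:Z)];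
    by rewrite !mem_sym_range; split; apply/andP; split; lia.
apply: (component_congr w0 (not_divides_den ji wj) (thetaP _ ba) (thetaP _ b'a)).
have -> : v i (- (2 * s) + b) - v j b = form U w.
  have -> : v j b = v j 0 + b%:~R * z by rewrite v_shift add0r.
  by rewrite /w scaleN1r linearB -v_shift /=; ring.
exact: divides_refl.
Qed.

(** As for the difference, with v_j + b z replaced by its opposite, since Phi is odd. *)
Lemma theta_add i j (s : int) : j != i -> (`|s| <= a)%N ->
  divides (form U (vrow F i (- (2 * s)) + 1 *: vrow F j 0)) (theta i + theta j).
Proof.
move=> ji sa; set w := _ + _.
have wj : w 0 (rshift 1 j) != 0 by rewrite pair_row_r // oner_eq0.
have w0 : w != 0 by apply: contra_neq wj => ->; rewrite mxE.
have [b [ba b'a]] : exists b, - (2 * s) - b \in sym_range a.+1 /\ b \in sym_range a.+1.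
  have [s0|s0] := lerP 0 s; [exists (- (2 * s) + a%:Z) | exists (- (2 * s) - a%:Z)];
    by rewrite !mem_sym_range; split; apply/andP; split; lia.
apply: (component_congrN w0 (not_divides_den ji wj) (thetaP _ ba) (thetaP _ b'a)).
have -> : v i (- (2 * s) - b) + v j b = form U w.
  have -> : v j b = v j 0 + b%:~R * z by rewrite v_shift add0r.
  by rewrite /w scale1r linearD -v_shiftN /=; ring.
exact: divides_refl.
Qed.

(* For |c| <= a two admissible points b, b' satisfy v_i + b z = - (v_i + b' z)
   modulo v_i - c z; otherwise c + b is a root of [num] for some admissible b. *)
Lemma theta_v i c : c \in sym_range r1 ++ sym_range r2 -> divides (v i (- c)) (theta i).
Proof.
move=> cr; have w0 := vrow_neq0 F i (- c).
have [ca|ac] := leqP `|c| a.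
  have [b [b' [ba b'a bb' bc]]] : exists b b', [/\ b \in sym_range a.+1,
      b' \in sym_range a.+1, b + b' = - c - c & b + c = a%:Z - `|c|%:Z].
    have [c0|c0] := lerP 0 c;
      [exists (a%:Z - c - c), (- a%:Z) | exists a%:Z, (- c - c - a%:Z)];
      by split; rewrite ?mem_sym_range;
        [apply/andP; split; lia | apply/andP; split; lia | lia | lia].
  have two : divides (v i (- c)) (theta i + theta i).
    apply: (component_congrN w0 _ (thetaP _ ba) (thetaP _ b'a)).
      move=> /(den_v_divides w0)[x xd /(v_divides U_free) E].
      (* A pole at a - |c| would belong to one of the two brackets: its size rules out the one that
         [c] comes from, parity the other. *)
      have xE : x = a%:Z - `|c|%:Z by lia.
      move: xd cr; rewrite xE !mem_cat !mem_sym_range.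
      by move=> /orP[] /andP[x1 x2] /orP[] /andP[c1 c2]; lia.
    have -> : b = - c + (b + c) by lia.
    have -> : b' = - c - (b + c) by lia.
    by rewrite -v_shift -v_shiftN; exists 2; ring.
  have -> : theta i = (2^-1 : F)%:MP * (theta i + theta i).
    rewrite -mulr2n -[theta i *+ 2]mulr_natl mulrA -mpolyC_nat -mpolyCM.
    by rewrite mulVf ?pnatr_eq0 // mul1r.
  exact: divides_mull.
have [b [ba cb]] : exists b, b \in sym_range a.+1 /\ c + b \in num_roots.
  have [c0|c0] := lerP 0 c; [exists (- a%:Z) | exists a%:Z];
    split; [|move: cr; rewrite !mem_cat| |move: cr; rewrite !mem_cat];
    rewrite !mem_sym_range; lia.
have : divides (v i (- c)) (den.[v i b] * theta i).
  rewrite (thetaP _ ba) /num hornerM; apply: divides_mulr.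
  rewrite root_polyE (big_rem _ cb) /= v_shiftN.
  have -> : b - (c + b) = - c by lia.
  exact/divides_mulr/divides_refl.
move=> /(form_prime U_free w0)[|//].
move=> /(den_v_divides w0)[x xd /(v_divides U_free) E].
have xE : x = b + c by lia.
move: xd ba cr; rewrite xE !mem_cat !mem_sym_range.
by move=> /orP[] /andP[x1 x2] /andP[b1 b2] /orP[] /andP[c1 c2]; lia.
Qed.

End OneField.
End Basis.

(** * Independence of the basic derivations *)

Section Determinant.
Variables (F : numFieldType) (N d : nat) (U : 'M[F]_(1 + d, N)).
Hypothesis U_free : row_free U.
Variables r1 r2 a : nat.
Hypothesis odd_r : odd (r1 + r2).
Local Notation P := {mpoly F[N]}.
Local Notation z := (form U (zrow F d)).
Local Notation v i c := (form U (vrow F i c)).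

Definition short_squares : seq P :=
  [seq v i c ^+ 2 | i <- enum 'I_d, c <- sym_range a].

Lemma size_short_squares : size short_squares = (d * a)%N.
Proof. by rewrite size_allpairs size_enum_ord size_sym_range. Qed.

(** The k zeros contribute the factor u^(2k), in which alone the right-hand sides for different k
    differ. *)
Definition node_squares k : seq P := short_squares ++ nseq k 0.

Lemma node_squares_homog k : {in node_squares k, forall y, y \is 2.-homog}.
Proof.
move=> y; rewrite mem_cat => /orP[/allpairsP[x [_ _ ->]]|].
  by apply: sqr_homog; apply: form_homog.
by rewrite mem_nseq => /andP[_ /eqP->]; apply: dhomog0.
Qed.

Lemma intz_neq0 (t : int) : t != 0 -> t%:~R * z != 0.
Proof. by move=> t0; rewrite mul_intz scaler_eq0 intr_eq0 (negPf t0) z_neq0. Qed.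

Lemma short_squares_neq0 (t : int) :
  \prod_(y <- short_squares) ((t%:~R * z) ^+ 2 - y) != 0.
Proof.
rewrite prodf_seq_neq0; apply/allP => _ /allpairsP[[i c] [_ _ ->]] /=.
rewrite subr_sqr mulf_neq0 //; last by rewrite addrC v_shift v_neq0.
by rewrite -opprB oppr_eq0 v_shiftN v_neq0.
Qed.

Section Independence.
Variable f : 'I_d -> {poly P}.
Hypothesis f_sol : forall k : 'I_d,
  even_solution z (r1%:Z - a%:Z) (r2%:Z - a%:Z)
    (fun u => z * u * \prod_(y <- node_squares k) (u ^+ 2 - y))
    (2 * (d * a + k)) (f k).

(** Applying the difference operator to a vanishing combination leaves a common factor times C(u^2),
    where C is the sum of the c_k X^k. At the positive multiples of z the common factor is nonzero,
    so C has more roots than its degree allows. *)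
Lemma solutions_free (c : 'rV[P]_d) : \sum_k c 0 k *: f k = 0 -> c = 0.
Proof.
move=> Q0; pose C : {poly P} := \poly_(k < d) (if insub k is Some i then c 0 i else 0).
have CE (t : nat) : C.[(t.+1%:~R * z) ^+ 2] = 0.
  pose u : P := t.+1%:~R * z.
  have u0 : u != 0 by apply: intz_neq0.
  have : \sum_k c 0 k * (z * u * \prod_(y <- node_squares k) (u ^+ 2 - y)) = 0.
    pose x1 := (u + (r1%:Z - a%:Z)%:~R * z) * (u + (r2%:Z - a%:Z)%:~R * z).
    pose x2 := (u - (r1%:Z - a%:Z)%:~R * z) * (u - (r2%:Z - a%:Z)%:~R * z).
    transitivity (x1 * (\sum_k c 0 k *: f k).[u + z] - x2 * (\sum_k c 0 k *: f k).[u - z]).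
      rewrite !horner_sum !mulr_sumr -sumrB; apply: eq_bigr => k _.
      have [_ _ _ /(_ u) <-] := f_sol k; rewrite !hornerZ -/x1 -/x2; ring.
    by rewrite Q0 !horner0 !mulr0 subrr.
  pose G := \prod_(y <- short_squares) (u ^+ 2 - y).
  have -> : \sum_k c 0 k * (z * u * \prod_(y <- node_squares k) (u ^+ 2 - y))
      = z * u * G * C.[u ^+ 2].
    rewrite horner_poly mulr_sumr; apply: eq_bigr => k _.
    rewrite big_cat /= big_nseq valK -/G.
    rewrite subr0 iter_mulr_1.
    by ring.
  have nz : z * u * G != 0.
    by apply: mulf_neq0; [apply: mulf_neq0; rewrite ?z_neq0 | apply: short_squares_neq0].
  by move/eqP; rewrite mulf_eq0 (negPf nz) => /eqP.
have C0 : C = 0.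
  apply/eqP; apply: contraT => Cn0.
  pose rs := [seq (t.+1%:~R * z) ^+ 2 | t <- iota 0 d].
  have := max_poly_roots Cn0 (rs := rs); rewrite size_map size_iota => H.
  suff : (d < size C)%N by rewrite ltnNge size_poly.
  apply: H; first by apply/allP => _ /mapP[t _ ->]; apply/eqP/CE.
  rewrite map_inj_uniq ?iota_uniq // => s t /eqP.
  rewrite -subr_eq0 subr_sqr -mulrBl -mulrDl mulf_eq0 -!(rmorphB, rmorphD) /=.
  case/orP; apply: contraTeq => st; apply: intz_neq0; lia.
apply/rowP => k; rewrite mxE; have := congr1 (fun p : {poly P} => p`_k) C0.
by rewrite coef_poly ltn_ord valK coef0.
Qed.

(* A vanishing combination of the rows would give a polynomial in u with the
   2 d (a + 1) roots +- (v_i + b z), more than its degree. *)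
Lemma components_det_neq0 (T : 'M[P]_d) :
  (forall k i b, b \in sym_range a.+1 ->
     (den U r1 r2 a).[v i b] * T k i = (num U r1 r2 a (f k)).[v i b]) ->
  \det T != 0.
Proof.
move=> TE; apply/det0P => -[c c0 cT]; case/eqP: c0; apply: solutions_free.
set Q := \sum_k _.
have Qv i b : b \in sym_range a.+1 -> Q.[v i b] = 0.
  move=> ba; have nz : (root_poly z (num_roots r1 r2 a)).[v i b] != 0.
    rewrite root_polyE prodf_seq_neq0; apply/allP => x _.
    by rewrite v_shiftN v_neq0.
  apply: (mulfI nz); rewrite mulr0 horner_sum mulr_sumr.
  transitivity ((den U r1 r2 a).[v i b] * (c *m T) 0 i); last by rewrite cT mxE mulr0.
  rewrite mxE mulr_sumr; apply: eq_bigr => k _.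
  by rewrite mulrCA TE // hornerM hornerZ mulrCA.
have QN u : Q.[- u] = Q.[u].
  rewrite !horner_sum; apply: eq_bigr => k _; have [_ fN _ _] := f_sol k.
  by rewrite !hornerZ fN.
pose S := [seq v i b | i <- enum 'I_d, b <- sym_range a.+1].
apply/eqP; apply: contraT => Q0.
have := max_poly_roots Q0 (rs := S ++ [seq - x | x <- S]).
rewrite size_cat size_map size_allpairs size_enum_ord size_sym_range => H.
have QS x : x \in S -> root Q x.
  by move=> /allpairsP[[i b] [_ ba ->]]; apply/eqP/Qv.
have sizeQ : (size Q <= 2 * (d * a + d))%N.
  rewrite (leq_trans (size_sum _ _ _)) //; apply/bigmax_leqP => k _.
  rewrite (leq_trans (size_scale_leq _ _)) //; have [sf _ _ _] := f_sol k.
  by rewrite (leq_trans sf) //; have := ltn_ord k; lia.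
suff : (d * a.+1 + d * a.+1 < size Q)%N.
  by move/leq_trans => /(_ _ sizeQ); rewrite mulnS; lia.
have Suniq : uniq S.
  apply: allpairs_uniq; rewrite ?enum_uniq ?sym_range_uniq //.
  by move=> [i b] [j b'] _ _ /= /(v_inj U_free)[-> ->].
apply: H.
  rewrite all_cat; apply/andP; split; apply/allP => x.
    exact: QS.
  by move=> /mapP[y yS ->]; rewrite rootE QN -rootE (QS y yS).
rewrite cat_uniq Suniq (map_inj_uniq oppr_inj) Suniq andbT /=.
apply/hasPn => _ /mapP[_ /allpairsP[[j b] [_ _ ->]] ->].
apply/negP => /allpairsP[[i b'] [_ _ /eqP]] /=; apply/negP.
by rewrite eq_sym v_oppr_neq.
Qed.

End Independence.

(** Row k of [T] holds the values of the k-th basic derivation on v_1, ..., v_d. The condition on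
    [e], written without subtraction, gives the degree of Phi for the k-th solution. *)
Lemma basis_exists (e : 'I_d -> nat) :
  (forall k, (e k + 2 * a = r1 + r2 + 2 * (d * a + k))%N) ->
  exists T : 'M[P]_d, [/\ \det T != 0,
    forall k i, T k i \is (e k).-homog,
    forall k i c, c \in sym_range r1 ++ sym_range r2 -> divides (v i (- c)) (T k i),
    forall k i j (s : int), j != i -> (`|s| <= a)%N ->
      divides (form U (vrow F i (- (2 * s)) + (-1) *: vrow F j 0)) (T k i - T k j)
  & forall k i j (s : int), j != i -> (`|s| <= a)%N ->
      divides (form U (vrow F i (- (2 * s)) + 1 *: vrow F j 0)) (T k i + T k j)].
Proof.
move=> he.
have odd_AB : odd `|(r1%:Z - a%:Z) + (r2%:Z - a%:Z)| by lia.
have hz := form_homog U (zrow F d).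
have /fin_all_exists[f f_sol] : forall k : 'I_d, exists f,
    even_solution z (r1%:Z - a%:Z) (r2%:Z - a%:Z)
    (fun u => z * u * \prod_(y <- node_squares k) (u ^+ 2 - y))
    (2 * (d * a + k)) f.
  move=> k; have [f hf] := even_solution_exists hz odd_AB (@node_squares_homog k).
  by exists f; move: hf; rewrite size_cat size_nseq size_short_squares.
have ys_v (k : 'I_d) i c : c \in sym_range a -> v i c ^+ 2 \in node_squares k.
  move=> ca; rewrite mem_cat; apply/orP; left.
  by apply: (allpairs_f (fun i c => v i c ^+ 2)); rewrite ?mem_enum.
have /fin_all_exists[th thE] : forall k : 'I_d, exists th : 'I_d -> P,
    forall i b, b \in sym_range a.+1 ->
      (den U r1 r2 a).[v i b] * th i = (num U r1 r2 a (f k)).[v i b].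
  move=> k; have := component_exists U_free (f_sol k) (ys_v k).
  by move=> /fin_all_exists[g gE]; exists g.
exists (\matrix_(k, i) th k i); split=> [|k i|k i c cr|k i j s ji sa|k i j s ji sa].
- by apply: (components_det_neq0 f_sol) => k i b ba; rewrite mxE thE.
- rewrite mxE; have ha : a%:Z \in sym_range a.+1.
    by rewrite mem_sym_range; apply/andP; split; lia.
  refine (component_homog U_free (f_sol k) (he k) (thE k i _ ha)).
- by rewrite mxE; apply: (theta_v U_free (f_sol k) odd_r (thE k)).
- rewrite !mxE; refine (theta_sub U_free odd_r (thE k) ji sa).
- rewrite !mxE; refine (theta_add U_free (f_sol k) odd_r (thE k) ji sa).
Qed.

End Determinant.

(** * Saito's criterion *)

Section Minors.
Variables (F : fieldType) (N : nat).
Local Notation P := {mpoly F[N]}.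

(** Multiplying the column T w^t by the adjugate gives det T times w^t, and some entry of w is an
    invertible scalar. *)
Lemma divides_det n (w : 'rV[F]_n) (T : 'M[P]_n) (p : P) : w != 0 ->
  (forall i, divides p (\sum_j w 0 j *: T i j)) -> divides p (\det T).
Proof.
move=> /row_neq0[j0 wj0] pT.
have : divides p (w 0 j0 *: \det T).
  have -> : w 0 j0 *: \det T = \sum_i \adj T j0 i * \sum_j w 0 j *: T i j.
    transitivity (\sum_j w 0 j *: (\adj T *m T) j0 j).
      rewrite mul_adj_mx (bigD1 j0) //= mxE eqxx big1 ?addr0 // => j jj0.
      by rewrite mxE eq_sym (negPf jj0) scaler0.
    under eq_bigr do rewrite mxE scaler_sumr.
    rewrite exchange_big; apply: eq_bigr => i _; rewrite mulr_sumr.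
    by apply: eq_bigr => j _; rewrite scalerAr.
  by apply: divides_sum => i; apply: divides_mull.
move=> [q E]; exists ((w 0 j0)^-1 *: q).
by rewrite -scalerAr -E scalerA mulVf // scale1r.
Qed.

(** Cramer's rule: it lets [divides_det] apply to the numerators of the coefficients of a
    derivation. *)
Lemma mul_adj_rowE n (g : 'rV[P]_n) (T : 'M[P]_n) k :
  (g *m \adj T) 0 k = \det (\matrix_(i, j) if i == k then g 0 j else T i j).
Proof.
rewrite (expand_det_row _ k) mxE; apply: eq_bigr => j _; rewrite !mxE eqxx.
congr (_ * (_ * \det _)); apply/matrixP => x y.
by rewrite !mxE eq_sym (negPf (neq_lift _ _)).
Qed.

Lemma lform_prod_divides (us : seq 'rV[F]_N) (p : P) :
  uniq us -> {in us, forall u, u != 0} ->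
  {in us &, forall u v c, v = c *: u -> v = u} ->
  {in us, forall u, divides (lform u) p} -> divides (\prod_(u <- us) lform u) p.
Proof.
elim: us p => [|u us IHus] p /=; first by exists p; rewrite big_nil mul1r.
move=> /andP[uus us_uniq] us0 uspair usp; have [q pE] := usp u (mem_head _ _).
have [| |v vus|r qE] := IHus q us_uniq.
- by move=> v vus; apply: us0; rewrite in_cons vus orbT.
- by move=> v v' vus v'us; apply: uspair; rewrite in_cons ?vus ?v'us orbT.
- have vus' : v \in u :: us by rewrite in_cons vus orbT.
  have := usp v vus'; rewrite pE => /(lform_prime (us0 _ vus'))[|//].
  move=> /(lform_divides_lform (us0 _ vus'))[c /(uspair _ _ vus' (mem_head _ _)) vu].
  by move: uus; rewrite vu vus.
by exists r; rewrite big_cons pE qE mulrA.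
Qed.

End Minors.

Section Saito.
Variables (R : realType) (V : vectType R).
Local Notation N := (\dim {:V}).
Local Notation P := (polyfun V).

(** Membership in D(A) quantifies over all forms with a given kernel; this reduces it to one form
    for each hyperplane. *)
Lemma lker_eq_scale (f g : 'Hom(V, R^o)) : lker f = lker g -> exists c, f = c *: g.
Proof.
move=> fg; have [g0|/lfunPn[x]] := eqVneq g 0.
  exists 0; rewrite scale0r; apply/lfunP => x; rewrite lfunE /=.
  by apply/eqP; rewrite -memv_ker fg g0 memv_ker lfunE.
rewrite lfunE /= => gx0; exists (f x / g x); apply/lfunP => y; rewrite lfunE /=.
have : y - (g y / g x) *: x \in lker f.
  rewrite fg memv_ker linearB linearZ /= subr_eq0; apply/eqP.
  by rewrite -[RHS]/(_ * _) divfK.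
rewrite memv_ker linearB linearZ /= subr_eq0 => /eqP ->.
by rewrite -[LHS]/(_ * _) -[RHS]/(_ * _) mulrAC [RHS]mulrAC [f x * _]mulrC.
Qed.

Definition coef_row (f : 'Hom(V, R^o)) : 'rV[R]_N :=
  \row_i (f (tnth (vbasis {:V}) i) : R).

Lemma form_polyE f : form_poly f = lform (coef_row f).
Proof. by apply: eq_bigr => i _; rewrite mxE. Qed.

Definition der_of (h : 'I_N -> P) (p : P) : P := \sum_i p^`M(i) * h i.

Lemma der_of_is_linear h : linear (der_of h).
Proof.
move=> c p q; rewrite /der_of scaler_sumr -big_split /=; apply: eq_bigr => i _.
by rewrite linearP mulrDl scalerAl.
Qed.

HB.instance Definition _ h := GRing.isLinear.Build R P P _ (der_of h)
  (der_of_is_linear h).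

Lemma der_ofX h i : der_of h 'X_i = h i.
Proof.
have dX j : 'X_i^`M(j) = (i == j)%:R :> P.
  rewrite mderivX mnm1E; case: eqVneq => [<-|_]; last by rewrite scale0r.
  rewrite scale1r -mpolyX0; congr 'X_[_].
  by apply/mnmP => k; rewrite mnmBE mnm0E subnn.
rewrite /der_of (bigD1 i) //= dX eqxx mul1r big1 ?addr0 // => j ji.
by rewrite dX eq_sym (negPf ji) mul0r.
Qed.

Lemma der_of_derivation h : is_derivation (der_of h).
Proof.
move=> p q; rewrite /der_of mulr_suml mulr_sumr -big_split /=.
by apply: eq_bigr => i _; rewrite mderivM; ring.
Qed.

Lemma derivationE (eta : {linear P -> P}) : is_derivation eta ->
  forall p, eta p = der_of (fun i => eta 'X_i) p.
Proof.
move=> der_eta; set h := fun i => _; have der_h := der_of_derivation h.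
have e1 (th : {linear P -> P}) : is_derivation th -> th 1 = 0.
  move=> /(_ 1 1); rewrite !mulr1 mul1r => /eqP.
  by rewrite -subr_eq0 opprD addrA subrr sub0r oppr_eq0 => /eqP.
elim/mpolyind => [|c m p _ _ IHp]; first by rewrite !linear0.
rewrite !linearD !linearZ IHp; congr (_ *: _ + _); rewrite mpolyXE_id.
have := (big_ind (fun q : P => eta q = der_of h q)); apply => [|p1 p2 E1 E2|i _].
- by rewrite !e1.
- by rewrite der_eta der_h E1 E2.
- elim: (m i) => [|k IHk]; first by rewrite expr0 !e1.
  by rewrite exprS der_eta der_h IHk /= der_ofX.
Qed.

Variables (A : arrangement V) (e : seq nat) (n : nat).
Variable (Y : 'I_n -> 'Hom(V, R^o)).
Variables (W : seq 'rV[R]_n) (T : 'M[P]_n).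

Definition comb (w : 'rV[R]_n) : 'Hom(V, R^o) := \sum_j w 0 j *: Y j.

Definition coord_mx : 'M[R]_(n, N) := \matrix_j coef_row (Y j).

Lemma form_poly_comb w : form_poly (comb w) = lform (w *m coord_mx).
Proof.
rewrite form_polyE; congr lform; apply/rowP => i.
rewrite !mxE sum_lfunE; apply: eq_bigr => j _.
by rewrite !mxE !lfunE.
Qed.

Hypothesis size_e : size e = n.
Hypothesis dimV : n = N.
Hypothesis Y_inj : forall x, (forall j, Y j x = 0) -> x = 0.

Lemma coord_mx_full : row_full coord_mx.
Proof.
rewrite /row_full -mxrank_tr -/(row_free _); apply: inj_row_free => v vU.
pose x := \sum_i v 0 i *: tnth (vbasis {:V}) i.
have x0 : x = 0.
  apply: Y_inj => j; have := congr1 (fun M : 'rV_n => M 0 j) vU.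
  rewrite !mxE => <-; rewrite linear_sum; apply: eq_bigr => i _.
  by rewrite linearZ !mxE.
have /freeP/(_ (fun i => v 0 i)) fb := basis_free (vbasisP {:V}).
apply/rowP => i; rewrite mxE; apply: fb; rewrite -[RHS]x0; apply: eq_bigr => k _.
by rewrite -tnth_nth.
Qed.

Lemma coord_mx_free : row_free coord_mx.
Proof.
by have /eqP rankE := coord_mx_full; rewrite /row_free rankE; apply/eqP/esym.
Qed.

Hypothesis A_W : forall H, H \in A -> exists2 w, w \in W & lker (comb w) = H.
Hypothesis W_A : forall w, w \in W -> lker (comb w) \in A.
Hypothesis W_uniq : uniq W.
Hypothesis W_neq0 : {in W, forall w, w != 0}.
Hypothesis W_pair : {in W &, forall w w' c, w' = c *: w -> w' = w}.
Hypothesis size_W : size W = sumn e.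
Hypothesis T_homog : forall k j, T k j \is (nth 0%N e k).-homog.
Hypothesis T_W : forall k w, w \in W ->
  divides (lform (w *m coord_mx)) (\sum_j w 0 j *: T k j).
Hypothesis det_T : \det T != 0.

Let Q : P := \prod_(w <- W) lform (w *m coord_mx).

Lemma Q_divides p : {in W, forall w, divides (lform (w *m coord_mx)) p} -> divides Q p.
Proof.
move=> Wp; have UI := row_free_inj coord_mx_free.
have -> : Q = \prod_(u <- [seq w *m coord_mx | w <- W]) lform u by rewrite big_map.
apply: lform_prod_divides.
- by rewrite map_inj_uniq //; exact: UI.
- by move=> _ /mapP[w wW ->]; rewrite mulmx_free_eq0 ?W_neq0 ?coord_mx_free.
- move=> _ _ /mapP[w wW ->] /mapP[w' w'W ->] c; rewrite scalemxAl => /UI.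
  by move=> /(W_pair wW w'W) ->.
- by move=> _ /mapP[w wW ->]; apply: Wp.
Qed.

(** Each form divides det T by [divides_det], hence so does their product Q. Both have as degree the
    sum of the exponents, which is the number of forms, so the quotient is a constant. *)
Lemma det_saito : exists2 c : R, c != 0 & \det T = c *: Q.
Proof.
have [r detE] : divides Q (\det T).
  apply: Q_divides => w wW; apply: (divides_det (W_neq0 wW)) => i; exact: T_W.
have Q0 : Q != 0 by apply: contraNneq det_T; rewrite detE => ->; rewrite mul0r.
have hQ : Q \is (sumn e).-homog.
  rewrite -size_W -sum1_size; apply: (dhomog_prod_seq (d := fun=> 1%N)) => w _.
  exact: lform_homog.
have : Q * r \is (sumn e + 0).-homog.
  rewrite -detE addn0 sumnE (big_nth 0%N) big_mkord size_e.
  exact: dhomog_det.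
move=> /(dhomog_factor Q0 hQ)/dhomog0_const rE.
exists (r@_0%MM); last by rewrite detE {1}rE mulrC mul_mpolyC.
by apply: contraNneq det_T => r0; rewrite detE rE r0 mulr0.
Qed.

(** Replacing a row of [T] by [g] keeps the divisibility conditions, so Q divides the numerators in
    Cramer's rule, whose denominator is a nonzero scalar times Q. *)
Lemma saito_coefficients (g : 'rV[P]_n) :
  (forall w, w \in W -> divides (lform (w *m coord_mx)) (\sum_j w 0 j *: g 0 j)) ->
  exists c : 'rV[P]_n, c *m T = g.
Proof.
move=> gW; have [c c0 detE] := det_saito.
have /fin_all_exists[x xE] : forall k, exists x, (g *m \adj T) 0 k = Q * x.
  move=> k; apply: Q_divides => w wW; rewrite mul_adj_rowE.
  apply: (divides_det (W_neq0 wW)) => i.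
  have [->|ik] := eqVneq i k.
    by under eq_bigr do rewrite mxE eqxx; apply: gW.
  by under eq_bigr do rewrite mxE (negPf ik); apply: T_W.
exists (c^-1%:MP *: \row_k x k).
have QE : (Q *: \row_k x k) *m T = \det T *: g.
  have -> : Q *: \row_k x k = g *m \adj T.
    by apply/rowP => k; rewrite xE !mxE.
  by rewrite -mulmxA mul_adj_mx mul_mx_scalar.
have Q0 : Q != 0 by apply: contraNneq det_T; rewrite detE => ->; rewrite scaler0.
rewrite -scalemxAl; apply/rowP => j; apply: (mulfI Q0).
have := congr1 (fun M : 'rV[P]_n => M 0 j) QE.
rewrite -scalemxAl mxE [in RHS]mxE detE => E.
rewrite mxE mulrCA E -scalerAl -mul_mpolyC mulrA -mpolyCM mulVf // mul1r //.
Qed.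

(** The values on the variables are chosen through the inverse of [coord_mx] so that the derivation
    sends the coordinate Y_j to [T k j]. *)
Lemma theta_comb w (th : {linear P -> P}) k :
  (forall i, th 'X_i = \sum_j pinvmx coord_mx i j *: T k j) ->
  th (lform (w *m coord_mx)) = \sum_j w 0 j *: T k j.
Proof.
move=> thX; rewrite /lform linear_sum /=.
under eq_bigr do rewrite linearZ /= thX scaler_sumr.
rewrite exchange_big; apply: eq_bigr => j _ /=.
under eq_bigr do rewrite scalerA.
rewrite -scaler_suml; congr (_ *: _).
have := congr1 (fun M : 'M_n => (w *m M) 0 j) (mulmxVp coord_mx_free).
by rewrite mulmxA mulmx1 mxE.
Qed.

Theorem saito_criterion : free_with_exponents A e.
Proof.
pose h (k : 'I_n) (i : 'I_N) : P := \sum_j pinvmx coord_mx i j *: T k j.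
pose th (k : 'I_n) : {linear P -> P} := der_of (h k).
have thX k i : th k 'X_i = h k i by exact: der_ofX.
have thW w k := theta_comb w (thX k).
exists (fun k => th (cast_ord size_e k)); split=> [k|k i|eta [der_eta eta_A]].
- split; first exact: der_of_derivation.
  move=> H al HA; have [w wW <-] := A_W HA => /lker_eq_scale[c alE].
  have -> : form_poly al = c *: form_poly (comb w).
    rewrite !form_polyE -linearZ; congr lform; apply/rowP => i.
    by rewrite alE !mxE lfunE.
  rewrite form_poly_comb linearZ /= thW; have [q ->] := T_W (cast_ord size_e k) wW.
  by exists q; rewrite scalerAl.
- by rewrite thX; apply: rpred_sum => j _; apply: rpredZ; apply: (T_homog (cast_ord size_e k)).
pose g : 'rV[P]_n := \row_j eta (lform (delta_mx 0 j *m coord_mx)).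
have etaW w : eta (lform (w *m coord_mx)) = \sum_j w 0 j *: g 0 j.
  rewrite {1}[w]row_sum_delta mulmx_suml (linear_sum (@lform R N)) linear_sum.
  by apply: eq_bigr => j _; rewrite -scalemxAl !linearZ mxE.
have [w wW|c cT] := @saito_coefficients g.
  have [q] := eta_A _ _ (W_A wW) (erefl _).
  by rewrite form_poly_comb etaW => ->; exists q.
have XE i : 'X_i = lform ((row i (pinvmx coord_mx)) *m coord_mx) :> P.
  rewrite -row_mul mulVpmx ?coord_mx_full // /lform (bigD1 i) //= !mxE eqxx scale1r.
  by rewrite big1 ?addr0 // => j ji; rewrite !mxE eq_sym (negPf ji) scale0r.
(* Derivations are determined by their values on the coordinates Y_j, so the expansions of [eta] are
   the solutions of c' T = g. *)
have etaE (c' : 'I_n -> P) :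
    (forall p, eta p = \sum_k c' k * th k p) <-> \row_k c' k *m T = g.
  split=> [E|E p].
    apply/rowP => j; rewrite !mxE E; apply: eq_bigr => k _.
    rewrite thW mxE (bigD1 j) //= mxE !eqxx scale1r big1 ?addr0 // => j' j'j.
    by rewrite mxE (negPf j'j) andbF scale0r.
  rewrite (derivationE der_eta) /der_of.
  transitivity (\sum_i p^`M(i) * \sum_k c' k * h k i); last first.
    under eq_bigr do rewrite mulr_sumr.
    rewrite exchange_big; apply: eq_bigr => k _ /=.
    have -> : th k p = \sum_i p^`M(i) * h k i by [].
    by rewrite mulr_sumr; apply: eq_bigr => i _; rewrite mulrCA.
  apply: eq_bigr => i _; congr (_ * _); rewrite XE etaW -E.
  under [in RHS]eq_bigr do rewrite /h mulr_sumr.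
  rewrite exchange_big; apply: eq_bigr => j _ /=.
  have -> : row i (pinvmx coord_mx) 0 j = pinvmx coord_mx i j by rewrite mxE.
  have -> : (\row_k c' k *m T) 0 j = \sum_k c' k * T k j.
    by rewrite mxE; apply: eq_bigr => k _; rewrite mxE.
  by rewrite scaler_sumr; apply: eq_bigr => k _; rewrite scalerAr.
pose cf : {ffun 'I_(size e) -> P} := [ffun k => c 0 (cast_ord size_e k)].
(* [size e] and [n] are equal but not convertible, hence the casts. *)
have reindexE (c' : {ffun 'I_(size e) -> P}) p :
    \sum_i c' i * th (cast_ord size_e i) p =
    \sum_k c' (cast_ord (esym size_e) k) * th k p.
  rewrite (reindex (cast_ord (esym size_e))) /=; last first.
    by exists (cast_ord size_e) => x _; rewrite ?cast_ordK ?cast_ordKV.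
  by apply: eq_bigr => k _; rewrite cast_ordKV.
exists cf; split=> [p|c' c'E].
  rewrite reindexE; move: p; apply/(etaE (fun k => cf (cast_ord (esym size_e) k))).
  by rewrite -cT; congr (_ *m _); apply/rowP => k; rewrite mxE ffunE cast_ordKV.
have /(etaE (fun k => c' (cast_ord (esym size_e) k))) c'T : forall p, eta p =
    \sum_k c' (cast_ord (esym size_e) k) * th k p.
  by move=> p; rewrite c'E reindexE.
have : (\row_k c' (cast_ord (esym size_e) k) - c) *m T = 0.
  by rewrite mulmxBl c'T cT subrr.
move=> /(congr1 (fun M => M *m \adj T)); rewrite -mulmxA mul_mx_adj mul0mx mul_mx_scalar.
move=> /rowP c'c; apply/ffunP => k; rewrite ffunE.
have /eqP := c'c (cast_ord size_e k); rewrite !mxE mulf_eq0 (negPf det_T) subr_eq0.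
by rewrite cast_ordK => /eqP.
Qed.

End Saito.

(** * The defining forms *)

Lemma mem_int_range k (s : int) : (s \in int_range k) = (`|s| <= k)%N.
Proof.
apply/mapP/idP => [[j]|sk]; first by rewrite mem_iota => /andP[_ jk] ->; lia.
by exists (absz (s + k%:Z)%R); [rewrite mem_iota|]; lia.
Qed.

Lemma int_range_uniq k : uniq (int_range k).
Proof. by rewrite map_inj_uniq ?iota_uniq // => i j; lia. Qed.

Section Rows.
Variables (F : numFieldType) (d a : nat) (cs : seq int).

Definition short_pairs : seq ('I_d * 'I_d) :=
  [seq p : 'I_d * 'I_d <- enum {: 'I_d * 'I_d} | (p.1 < p.2)%N].

(** The square of indices splits into the diagonal and two triangles exchanged by symmetry. *)
Lemma size_short_pairs : (2 * size short_pairs + d = d * d)%N.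
Proof.
rewrite size_filter -sum1_count big_enum_cond /= big_mkcond /=.
rewrite -(pair_bigA _ (fun i j : 'I_d => (if i < j then 1 else 0)%N)) /=.
set S := (\sum_i \sum_j _)%N.
have SE : S = (\sum_(i < d) \sum_(j < d) (if j < i then 1 else 0))%N.
  by rewrite /S exchange_big.
have dE : d = (\sum_(i < d) \sum_(j < d) (if i == j then 1 else 0))%N.
  rewrite -[LHS](card_ord d) -sum1_card; apply: eq_bigr => i _.
  by rewrite -big_mkcond (big_pred1 i) // => j; rewrite /= eq_sym.
transitivity (S + \sum_(i < d) \sum_(j < d) (if j < i then 1 else 0)
  + \sum_(i < d) \sum_(j < d) (if i == j then 1 else 0))%N.
  by rewrite -SE -dE mul2n addnn.
rewrite -!big_split /=.
transitivity (\sum_(i < d) \sum_(j < d) 1)%N; last first.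
  by rewrite !sum_nat_const card_ord muln1.
apply: eq_bigr => i _; rewrite -!big_split; apply: eq_bigr => j _ /=.
by rewrite -(inj_eq val_inj) /=; case: ltngtP.
Qed.

Definition short_row (x : ('I_d * 'I_d) * (int * bool)) : 'rV[F]_(1 + d) :=
  vrow F x.1.1 (- (2 * x.2.1)) + (-1) ^+ x.2.2 *: vrow F x.1.2 0.

Definition short_signs : seq (int * bool) :=
  [seq (s, b) | s <- int_range a, b <- [:: false; true]].

Definition rows : seq 'rV[F]_(1 + d) :=
  zrow F d :: [seq vrow F i (- c) | i <- enum 'I_d, c <- cs]
  ++ [seq short_row (p, x) | p <- short_pairs, x <- short_signs].

Lemma short_row_r x k : short_row x 0 (rshift 1 k) =
  (x.1.1 == k)%:R + (-1) ^+ x.2.2 * (x.1.2 == k)%:R.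
Proof. by rewrite [LHS]mxE [X in _ + X]mxE !vrow_r. Qed.

Lemma short_row_l x : short_row x 0 (lshift d 0) = (- (2 * x.2.1))%:~R.
Proof. by rewrite [LHS]mxE [X in _ + X]mxE !vrow_l mulr0 addr0. Qed.

Variant rows_spec : 'rV[F]_(1 + d) -> Prop :=
| RowZ : rows_spec (zrow F d)
| RowV i c of c \in cs : rows_spec (vrow F i (- c))
| RowS (i j : 'I_d) (s : int) (b : bool) of (i < j)%N & (`|s| <= a)%N :
    rows_spec (short_row ((i, j), (s, b))).

Lemma rowsP w : w \in rows -> rows_spec w.
Proof.
rewrite in_cons mem_cat => /orP[/eqP->|/orP[]]; first exact: RowZ.
  by move=> /allpairsP[[i c] [_ cc ->]]; exact: RowV.
move=> /allpairsP[[[i j] x] [/=]]; rewrite mem_filter => /andP[ij _].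
move=> /allpairsP[[s b] [/=]]; rewrite mem_int_range => sa _ -> ->.
exact: RowS.
Qed.

Lemma mem_rowsZ : zrow F d \in rows.
Proof. exact: mem_head. Qed.

Lemma mem_rowsV i c : c \in cs -> vrow F i (- c) \in rows.
Proof.
move=> cc; rewrite in_cons mem_cat; apply/or3P; constructor 2.
by apply: (allpairs_f (fun i c => vrow F i (- c))); rewrite ?mem_enum.
Qed.

Lemma mem_rowsS (i j : 'I_d) s (b : bool) :
  (i < j)%N -> (`|s| <= a)%N -> short_row ((i, j), (s, b)) \in rows.
Proof.
move=> ij sa; rewrite in_cons mem_cat; apply/or3P; constructor 3.
apply: (allpairs_f (fun p x => short_row (p, x))).
  by rewrite mem_filter ij mem_enum.
by apply: (allpairs_f pair); rewrite ?mem_int_range //; case: (b).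
Qed.

(* Two proportional rows share the index of their first nonzero coordinate
   (that of [z] being put last), where both are equal to 1. *)
Lemma rows_lead w : w \in rows -> w = zrow F d \/
  exists2 i : 'I_d, w 0 (rshift 1 i) = 1 &
    forall k : 'I_d, (k < i)%N -> w 0 (rshift 1 k) = 0.
Proof.
move=> /rowsP[|i c _|i j s b ij _]; [by left | right; exists i | right; exists i].
- by rewrite vrow_r eqxx.
- by move=> k ki; rewrite vrow_r -(inj_eq val_inj) /= gtn_eqF.
- by rewrite short_row_r /= eqxx -(inj_eq val_inj) /= gtn_eqF // mulr0 addr0.
- move=> k ki; rewrite short_row_r /= -!(inj_eq val_inj) /= !gtn_eqF ?mulr0 ?addr0 //.
  exact: ltn_trans ij.
Qed.

Lemma rows_neq0 : {in rows, forall w, w != 0}.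
Proof.
move=> w /rows_lead[->|[i wi _]]; first exact: zrow_neq0.
by apply: contra_eq_neq wi => ->; rewrite mxE eq_sym oner_neq0.
Qed.

Lemma rows_pair : {in rows &, forall w w' c, w' = c *: w -> w' = w}.
Proof.
move=> w w' wW w'W c w'E.
have E k : w' 0 k = c * w 0 k by rewrite w'E mxE.
have [wz|[i wi wlt]] := rows_lead wW; have [w'z|[i' w'i w'lt]] := rows_lead w'W.
- by rewrite wz w'z.
- by have /eqP := E (rshift 1 i'); rewrite w'i wz zrow_r mulr0 oner_eq0.
- have := E (rshift 1 i); rewrite w'z zrow_r wi mulr1 => c0.
  have := E (lshift d 0); rewrite w'z zrow_l -c0 mul0r => /eqP.
  by rewrite oner_eq0.
have Ei := E (rshift 1 i); have Ei' := E (rshift 1 i').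
rewrite wi mulr1 in Ei; rewrite w'i in Ei'.
case: (ltngtP i i') => [ii'|i'i|ii'].
- by move: Ei Ei'; rewrite w'lt // => <- /eqP; rewrite mul0r oner_eq0.
- by move: Ei'; rewrite wlt // mulr0 => /eqP; rewrite oner_eq0.
have /val_inj ii'E := ii'.
by rewrite w'E -Ei ii'E w'i scale1r.
Qed.

Lemma rows_uniq : uniq cs -> uniq rows.
Proof.
move=> cs_uniq; have zr w : w \in [seq vrow F i (- c) | i <- enum 'I_d, c <- cs]
  ++ [seq short_row (p, x) | p <- short_pairs, x <- short_signs] -> w != zrow F d.
  rewrite mem_cat => wW; apply/eqP => wz; move: wW; rewrite {}wz => /orP[].
    move=> /allpairsP[[i c] [_ _ E]].
    have /eqP := congr1 (fun w : 'rV[F]_(1 + d) => w 0 (rshift 1 i)) E.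
    by rewrite zrow_r vrow_r eqxx eq_sym oner_eq0.
  move=> /allpairsP[[[i j] x] [/=]]; rewrite mem_filter => /andP[/= ij _] _ E.
  have /eqP := congr1 (fun w : 'rV[F]_(1 + d) => w 0 (rshift 1 i)) E.
  rewrite zrow_r short_row_r /= eqxx -(inj_eq val_inj) /= gtn_eqF //.
  by rewrite mulr0 addr0 eq_sym oner_eq0.
rewrite /rows cons_uniq; apply/andP; split; first by apply/negP => /zr; rewrite eqxx.
rewrite cat_uniq; apply/and3P; split.
- apply: allpairs_uniq; rewrite ?enum_uniq // => -[i c] [j c'] _ _ /= E.
  have := congr1 (fun w : 'rV[F]_(1 + d) => w 0 (rshift 1 i)) E; rewrite !vrow_r eqxx.
  have [->|_ /eqP] := eqVneq j i; last by rewrite oner_eq0.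
  have := congr1 (fun w : 'rV[F]_(1 + d) => w 0 (lshift d 0)) E; rewrite !vrow_l.
  by move=> /intr_inj /oppr_inj ->.
- apply/hasPn => w inS.
  have /allpairsP[[[i j] [s b]] [pS _ wE]] : w \in
    [seq short_row (p, x) | p <- short_pairs, x <- short_signs] := inS.
  rewrite {}wE in inS *.
  move: pS; rewrite mem_filter => /andP[/= ij _].
  apply/negP => inV.
  have /allpairsP[[k c] [_ _ /= E]] : short_row ((i, j), (s, b)) \in
    [seq vrow F i (- c) | i <- enum 'I_d, c <- cs] := inV.
  (* [short_row] has two nonzero coordinates along the v_k, [vrow] only one. *)
  have := congr1 (fun w : 'rV[F]_(1 + d) => w 0 (rshift 1 i)) E.
  have /eqP := congr1 (fun w : 'rV[F]_(1 + d) => w 0 (rshift 1 j)) E.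
  rewrite !short_row_r /= !vrow_r !eqxx -!(inj_eq val_inj) /= (gtn_eqF ij) (ltn_eqF ij).
  rewrite mulr0 addr0 add0r mulr1.
  have [->|_] := eqVneq (k : nat) j.
    by rewrite gtn_eqF // => _ /eqP; rewrite oner_eq0.
  by rewrite signr_eq0.
apply: (allpairs_uniq (f := fun p x => short_row (p, x))).
- by rewrite filter_uniq // enum_uniq.
- apply: allpairs_uniq => //; first exact: int_range_uniq.
  by move=> [s b] [s' b'] _ _ /= [-> ->].
move=> [[i j] [s b]] [[i' j'] [s' b']].
move=> /allpairsP[x [xS _ [xE _]]] /allpairsP[x' [x'S _ [x'E _]]] E.
move: xS x'S; rewrite -xE -x'E !mem_filter => /andP[/= ij _] /andP[/= i'j' _].
(* The first nonzero coordinate determines i, the second one j and the sign, and the coordinate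
   along z determines s. *)
have Er (k : 'I_d) : (i == k)%:R + (-1) ^+ b * (j == k)%:R =
    (i' == k)%:R + (-1) ^+ b' * (j' == k)%:R :> F.
  by have := congr1 (fun w : 'rV[F]_(1 + d) => w 0 (rshift 1 k)) E; rewrite !short_row_r.
have := Er i; have := Er i'; have := Er j; rewrite !eqxx -!(inj_eq val_inj) /=.
case: (ltngtP i i') => [ii'|i'i|/val_inj ii'].
- rewrite [(j == i :> nat)]gtn_eqF // [(j' == i :> nat)]gtn_eqF ?(ltn_trans ii') //.
  by rewrite !mulr0 !addr0 => _ _ /eqP; rewrite oner_eq0.
- rewrite [(j' == i' :> nat)]gtn_eqF // [(j == i' :> nat)]gtn_eqF ?(ltn_trans i'i) //.
  by rewrite !mulr0 !addr0 => _ /eqP; rewrite eq_sym oner_eq0.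
rewrite -{}ii' in i'j' E *; rewrite ltn_eqF // !add0r mulr1.
have [j'j|_] := eqVneq (j' : nat) j; last by rewrite mulr0 => /eqP; rewrite signr_eq0.
rewrite mulr1 => /eqP; rewrite (inj_eq (@signr_inj F)) => /eqP bb' _ _.
have := congr1 (fun w : 'rV[F]_(1 + d) => w 0 (lshift d 0)) E; rewrite !short_row_l /=.
move=> /intr_inj ss'; have -> : s = s' by lia.
by rewrite bb' (val_inj j'j).
Qed.

Lemma size_rows : size rows =
  (1 + (d * size cs + size short_pairs * (2 * (2 * a).+1)))%N.
Proof.
have sizeS : size short_signs = (2 * (2 * a).+1)%N.
  by rewrite size_allpairs size_map size_iota mulnC.
by rewrite /rows -cat1s !size_cat 2!size_allpairs size_enum_ord sizeS.
Qed.

End Rows.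

(** * Freeness *)

Section TypeC.
Variables (R : realType) (V : vectType R) (d : nat).
Variables (z : 'Hom(V, R^o)) (v : 'I_d -> 'Hom(V, R^o)).

(** This class of arrangements contains the cone and all its restrictions along the flag; [cs] lists
    the c for which v_i = c z is a hyperplane. *)
Variant type_C_form (cs : seq int) (a : nat) : 'Hom(V, R^o) -> Prop :=
| FormZ : type_C_form cs a z
| FormV i c of c \in cs : type_C_form cs a (v i - c%:~R *: z)
| FormS (i j : 'I_d) (s : int) (b : bool) of (i < j)%N & (`|s| <= a)%N :
    type_C_form cs a (v i + (-1) ^+ b *: v j - (2 * s)%:~R *: z).

Definition coordinates (j : 'I_(1 + d)) : 'Hom(V, R^o) :=
  match split j with inl _ => z | inr i => v i end.

Lemma coordinates_l j : coordinates (lshift d j) = z.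
Proof. by rewrite /coordinates (unsplitK (inl j)). Qed.

Lemma coordinates_r i : coordinates (rshift 1 i) = v i.
Proof. by rewrite /coordinates (unsplitK (inr i)). Qed.

Local Notation cmb := (comb coordinates).

Lemma comb_zrow : cmb (zrow R d) = z.
Proof.
rewrite /comb big_split_ord big_ord1 /= coordinates_l zrow_l scale1r.
by rewrite big1 ?addr0 // => i _; rewrite zrow_r scale0r.
Qed.

Lemma comb_vrow i c : cmb (vrow R i c) = v i + c%:~R *: z.
Proof.
rewrite /comb big_split_ord big_ord1 /= coordinates_l vrow_l addrC; congr (_ + _).
rewrite (bigD1 i) //= vrow_r coordinates_r eqxx scale1r big1 ?addr0 // => j ji.
by rewrite vrow_r eq_sym (negPf ji) scale0r.
Qed.

Lemma combD u w : cmb (u + w) = cmb u + cmb w.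
Proof.
by rewrite /comb -big_split; apply: eq_bigr => j _; rewrite mxE scalerDl.
Qed.

Lemma combZ c w : cmb (c *: w) = c *: cmb w.
Proof.
by rewrite /comb scaler_sumr; apply: eq_bigr => j _; rewrite mxE scalerA.
Qed.

Lemma comb_short_row i j s b : cmb (short_row R ((i, j), (s, b))) =
  v i + (-1) ^+ b *: v j - (2 * s)%:~R *: z.
Proof.
rewrite /short_row combD combZ !comb_vrow scale0r addr0 rmorphN scaleNr.
by rewrite addrAC.
Qed.

Lemma type_C_form_rows cs a f :
  type_C_form cs a f <-> exists2 w, w \in rows R d a cs & cmb w = f.
Proof.
split=> [[|i c cc|i j s b ij sa]|[w /rowsP[|i c cc|i j s b ij sa] <-]].
- by exists (zrow R d); [exact: mem_rowsZ | exact: comb_zrow].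
- exists (vrow R i (- c)); first exact: mem_rowsV.
  by rewrite comb_vrow rmorphN scaleNr.
- exists (short_row R ((i, j), (s, b))); first exact: mem_rowsS.
  exact: comb_short_row.
- by rewrite comb_zrow; exact: FormZ.
- by rewrite comb_vrow rmorphN scaleNr; exact: FormV.
- by rewrite comb_short_row; exact: FormS.
Qed.

Hypothesis dimV : (1 + d)%N = \dim {:V}.
Hypothesis coord_inj : forall x, z x = 0 -> (forall i, v i x = 0) -> x = 0.

Lemma coordinates_inj x : (forall j, coordinates j x = 0) -> x = 0.
Proof.
move=> x0; apply: coord_inj => [|i].
  by rewrite -(coordinates_l ord0).
by rewrite -coordinates_r.
Qed.

Lemma type_C_form_neq0 cs a f : type_C_form cs a f -> f != 0.
Proof.
move=> /type_C_form_rows[w wW <-]; apply: contraTneq (rows_neq0 wW) => w0.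
rewrite negbK; have U_free := coord_mx_free dimV coordinates_inj.
rewrite -(mulmx_free_eq0 _ U_free) -lform_eq0 -form_poly_comb w0 /form_poly.
by apply/eqP; rewrite big1 // => i _; rewrite lfunE scale0r.
Qed.

Lemma sumn_exponents b n : (sumn [seq b + 2 * k | k <- iota 0 n] + n = n * b + n * n)%N.
Proof.
elim: n => // n IHn; have -> : iota 0 n.+1 = iota 0 n ++ [:: n] by rewrite -addn1 iotaD.
rewrite map_cat sumn_cat /= addn0.
by move: IHn; move: (sumn _) => S; nia.
Qed.

Lemma type_C_free (A : arrangement V) (r1 r2 a b : nat) (cs : seq int) :
  odd (r1 + r2) -> cs =i sym_range r1 ++ sym_range r2 ->
  (b + 2 * a = r1 + r2 + 2 * (d * a))%N ->
  (forall H, H \in A <-> exists2 f, type_C_form cs a f & H = lker f) ->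
  free_with_exponents A (1%N :: [seq (b + 2 * k)%N | k <- iota 0 d]).
Proof.
move=> odd_r csE bE AE; set e := _ :: _.
have size_e : size e = (1 + d)%N by rewrite /= size_map size_iota.
have eE (k : 'I_d) : nth 0%N e (rshift 1 k) = (b + 2 * k)%N.
  by rewrite /= add0n (nth_map 0%N) ?size_iota ?nth_iota ?add0n ?ltn_ord.
pose ds := sym_range r1 ++ sym_range r2.
(* r1 and r2 have opposite parities, so the two progressions are disjoint. *)
have ds_uniq : uniq ds.
  rewrite cat_uniq !sym_range_uniq andbT; apply/hasPn => c.
  by rewrite mem_sym_range => ?; apply/negP; rewrite /= mem_sym_range; lia.
have size_ds : size ds = (r1 + r2)%N by rewrite size_cat !size_sym_range.
have formE f : type_C_form cs a f <-> type_C_form ds a f.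
  split; case=> [|i c|i j s b' ij sa].
  - exact: FormZ.
  - by rewrite csE; exact: FormV.
  - exact: FormS.
  - exact: FormZ.
  - by rewrite -csE; exact: FormV.
  - exact: FormS.
have U_free := coord_mx_free dimV coordinates_inj.
pose U := coord_mx coordinates.
have /(basis_exists U_free odd_r)[T [det_T T_homog T_v T_sub T_add]] :
    forall k : 'I_d, (b + 2 * k + 2 * a = r1 + r2 + 2 * (d * a + k))%N by lia.
(* The first row is the Euler derivation, of degree 1; the zero block says that the other
   derivations kill z. The determinant is z times det T. *)
pose B : 'M[polyfun V]_(1 + d) := block_mx
  (\matrix_(i, j) lform (row (lshift d j) U)) (\matrix_(i, j) lform (row (rshift 1 j) U))
  0 T.
have Bl k j : B (lshift d k) j = lform (row j U).
  by rewrite -[j]splitK; case: (split j) => j'; rewrite ?block_mxEul ?block_mxEur mxE.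
have Br k w : \sum_j w 0 j *: B (rshift 1 k) j = \sum_i w 0 (rshift 1 i) *: T k i.
  rewrite big_split_ord big_ord1 /= block_mxEdl mxE scaler0 add0r.
  by apply: eq_bigr => i _; rewrite block_mxEdr.
have sumT (u : 'I_d -> R) k i : (forall j, j != i -> u j = 0) ->
    \sum_j u j *: T k j = u i *: T k i.
  by move=> u0; rewrite (bigD1 i) //= big1 ?addr0 // => j ji; rewrite u0 // scale0r.
apply: (@saito_criterion _ _ _ _ (1 + d) coordinates (rows R d a ds) B) => //.
- exact: coordinates_inj.
- move=> H /AE[f /formE/type_C_form_rows[w wW <-] ->]; by exists w.
- move=> w wW; apply/AE; exists (cmb w) => //.
  by apply/formE/type_C_form_rows; exists w.
- exact: rows_uniq.
- exact: rows_neq0.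
- exact: rows_pair.
(* Both numbers are 1 + d (r1 + r2) + d (d - 1) (2 a + 1). *)
- rewrite size_rows size_ds; move: (size_short_pairs d) (sumn_exponents b d) => /=.
  by move: (size _) (sumn _) => p S; nia.
- move=> k j; rewrite -[k]splitK; case: (split k) => k'.
    by rewrite Bl ord1; exact: lform_homog.
  rewrite eE; rewrite -[j]splitK; case: (split j) => j'.
    by rewrite block_mxEdl mxE; exact: dhomog0.
  by rewrite block_mxEdr; exact: T_homog.
- move=> k w wW; rewrite -[k]splitK; case: (split k) => k'.
    under eq_bigr do rewrite Bl -linearZ /=.
    by rewrite -linear_sum -mulmx_sum_row; exact: divides_refl.
  rewrite Br; case/rowsP: wW => [|i c cc|i j s b' ij sa].
  + by rewrite big1 => [|i _]; [exact: divides0 | rewrite zrow_r scale0r].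
  + rewrite (sumT _ _ i) => [|j ji]; last by rewrite vrow_r eq_sym (negPf ji).
    by rewrite vrow_r eqxx scale1r; exact: T_v.
  + have ji : j != i by rewrite -(inj_eq val_inj) /= gtn_eqF.
    under eq_bigr do rewrite short_row_r scalerDl.
    rewrite big_split /= (sumT (fun k => (i == k)%:R) _ i); last first.
      by move=> x; rewrite eq_sym => /negPf->.
    rewrite (sumT (fun k => (-1) ^+ b' * (j == k)%:R) _ j); last first.
      by move=> x; rewrite eq_sym => /negPf->; rewrite mulr0.
    rewrite !eqxx mulr1 scale1r /short_row /=.
    case: b'; rewrite ?expr1 ?expr0 ?scaleN1r ?scale1r.
      by have := T_sub k' i j s ji sa; rewrite scaleN1r.
    by have := T_add k' i j s ji sa; rewrite scale1r.
- rewrite det_ublock mulf_neq0 // det_mx11 mxE lform_eq0.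
  apply/negP => /eqP r0.
  have := mulmx_free_eq0 (delta_mx 0 (lshift d 0) : 'rV[R]_(1 + d)) U_free.
  rewrite -rowE r0 eqxx => /esym/eqP/rowP/(_ (lshift d 0)) /eqP.
  by rewrite !mxE !eqxx oner_eq0.
Qed.

End TypeC.

(** * Restrictions and the cone *)

Section Restriction.
Variables (R : realType) (V : vectType R).

Definition restrict_form (X : {vspace V}) (f : 'Hom(V, R^o)) : 'Hom(subvs_of X, R^o) :=
  (f \o linfun (@vsval R V X))%VF.

Lemma restrict_formE X f u : restrict_form X f u = f (vsval u).
Proof. by rewrite comp_lfunE lfunE. Qed.

Lemma restrict_form_is_linear X : linear (restrict_form X).
Proof.
move=> c f g; apply/lfunP => u.
by rewrite add_lfunE scale_lfunE !restrict_formE add_lfunE scale_lfunE.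
Qed.

HB.instance Definition _ X := GRing.isLinear.Build R _ _ _ (restrict_form X)
  (restrict_form_is_linear X).

Lemma restrict_formBZ X f h k :
  restrict_form X (f - k *: h) = restrict_form X f - k *: restrict_form X h.
Proof. by rewrite linearB linearZ. Qed.

Lemma restrict_formDZBZ X f g h c k : restrict_form X (f + c *: g - k *: h) =
  restrict_form X f + c *: restrict_form X g - k *: restrict_form X h.
Proof. by rewrite restrict_formBZ linearD linearZ. Qed.

Lemma lker_restrict X f :
  (linfun (@vsval R V X) @^-1: lker f)%VS = lker (restrict_form X f).
Proof.
by apply/vspaceP => u; rewrite -memv_preim !memv_ker lfunE restrict_formE.
Qed.

Lemma restrict_form_eq0 X f : (restrict_form X f == 0) = (X <= lker f)%VS.
Proof.
apply/eqP/subvP => [f0 x xX|fX].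
  rewrite memv_ker -[x](vsprojK xX) -(restrict_formE f) f0 lfunE //.
apply/lfunP => u; rewrite restrict_formE lfunE /=; apply/eqP.
by rewrite -memv_ker fX // subvsP.
Qed.

Lemma mem_restriction (A : arrangement V) X H (P : 'Hom(V, R^o) -> Prop) :
  (forall H0, H0 \in A <-> exists2 f, P f & H0 = lker f) ->
  H \in restriction A X <->
  exists f, [/\ P f, restrict_form X f != 0 & H = lker (restrict_form X f)].
Proof.
move=> AE; split=> [/mapP[H0]|[f [Pf f0 ->]]].
  rewrite mem_filter => /andP[XH0 /AE[f Pf H0E]] ->; exists f.
  by rewrite H0E in XH0 *; rewrite restrict_form_eq0 lker_restrict.
apply/mapP; exists (lker f); last by rewrite lker_restrict.
by rewrite mem_filter -restrict_form_eq0 f0; apply/AE; exists f.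
Qed.

Lemma mem_bigcap_seq (B : seq {vspace V}) x :
  (x \in \bigcap_(H <- B) H)%VS = all (fun H : {vspace V} => x \in H) B.
Proof.
elim: B => [|H B IHB] /=; first by rewrite big_nil memvf.
by rewrite big_cons memv_cap IHB.
Qed.

Lemma lker_scale (c : R) (f : 'Hom(V, R^o)) : c != 0 -> lker (c *: f) = lker f.
Proof.
move=> c0; apply/vspaceP => x; rewrite !memv_ker scale_lfunE.
by rewrite scaler_eq0 (negPf c0).
Qed.

End Restriction.

(** * The cone in the coordinates z and v_i = 2 x_i *)

Section Cone.
Variables (R : realType) (l : nat).
Local Notation V := 'rV[R]_(l + 1).

Definition dot n (w x : 'rV[R]_n) : R^o := \sum_j w 0 j * x 0 j.

Lemma dot_is_linear n (w : 'rV[R]_n) : linear (dot w).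
Proof.
move=> c x y; rewrite /dot scaler_sumr -big_split /=; apply: eq_bigr => j _.
by rewrite !mxE mulrDr; congr (_ + _); rewrite mulrCA.
Qed.

HB.instance Definition _ n w := GRing.isLinear.Build R 'rV[R]_n R^o _ (dot w)
  (@dot_is_linear n w).

Definition dform (w : V) : 'Hom(V, R^o) := linfun (dot w).

Lemma dformE w x : dform w x = dot w x.
Proof. exact: lfunE. Qed.

Lemma kernel_ofE w : kernel_of w = lker (dform w).
Proof. by []. Qed.

Lemma dform_is_linear : linear dform.
Proof.
move=> c u w; apply/lfunP => x; rewrite add_lfunE scale_lfunE !dformE /dot.
rewrite scaler_sumr -big_split /=; apply: eq_bigr => j _.
by rewrite !mxE mulrDl -mulrA.
Qed.

HB.instance Definition _ := GRing.isLinear.Build R V _ _ dform dform_is_linear.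

Definition z_form : 'Hom(V, R^o) := dform (row_mx 0 1%:M).
Definition v_form (i : 'I_l) : 'Hom(V, R^o) := 2 *: dform (row_mx (coord_form R i) 0).

Lemma z_formE x : z_form x = x 0 (rshift l 0).
Proof.
rewrite dformE /dot big_split_ord big_ord1 /= row_mxEr mxE mul1r.
by rewrite big1 ?add0r // => j _; rewrite row_mxEl mxE mul0r.
Qed.

Lemma v_formE i x : v_form i x = 2 * x 0 (lshift 1 i).
Proof.
rewrite scale_lfunE dformE /dot big_split_ord big_ord1 /= row_mxEr mxE mul0r addr0.
rewrite (bigD1 i) //= row_mxEl mxE !eqxx mul1r big1 ?addr0 // => j ji.
by rewrite row_mxEl mxE (negPf ji) andbF mul0r.
Qed.

Lemma dform_row (u : 'rV[R]_l) (s : R) :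
  dform (row_mx u (- s)%:M) = dform (row_mx u 0) - s *: z_form.
Proof.
rewrite -linearZ -linearB; congr dform.
rewrite scale_row_mx scaler0 opp_row_mx add_row_mx oppr0 addr0 add0r.
by rewrite scale_scalar_mx mulr1 raddfN.
Qed.

Lemma long_hyperplane i (s : int) :
  kernel_of (row_mx (2 *: coord_form R i) (- s%:~R)%:M) =
  lker (v_form i - s%:~R *: z_form).
Proof.
rewrite kernel_ofE dform_row -[X in row_mx _ X](scaler0 _ 2) -scale_row_mx.
by rewrite linearZ.
Qed.

Lemma short_hyperplane (i j : 'I_l) (b : bool) (s : int) :
  kernel_of (row_mx (coord_form R i + (-1) ^+ b *: coord_form R j) (- s%:~R)%:M) =
  lker (v_form i + (-1) ^+ b *: v_form j - (2 * s)%:~R *: z_form).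
Proof.
(* The equation x_i +- x_j = s z is doubled. *)
rewrite kernel_ofE -(@lker_scale _ _ 2) ?pnatr_eq0 // dform_row /v_form.
congr lker; rewrite scalerBr rmorphM -scalerA; congr (_ - _).
rewrite [_ *: (2 *: _)]scalerA mulrC -scalerA -scalerDr; congr (_ *: _).
have -> : row_mx (coord_form R i + (-1) ^+ b *: coord_form R j) 0 =
    row_mx (coord_form R i) 0 + (-1) ^+ b *: row_mx (coord_form R j) 0 :> V.
  by rewrite scale_row_mx add_row_mx scaler0 addr0.
by rewrite linearD linearZ.
Qed.

Lemma mem_cone_C0 m a H : H \in cone (C0 R l m a) <->
  exists2 f, type_C_form z_form v_form (int_range m) a f & H = lker f.
Proof.
rewrite in_cons; split.
  case/orP=> [/eqP->|/mapP[h]]; first by exists z_form; [exact: FormZ | ].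
  rewrite mem_cat => /orP[] /allpairsP[[u s] [/= uS sS ->]] -> /=.
    move: sS; rewrite mem_int_range => sa.
    move: uS; rewrite mem_cat => /orP[] /mapP[[i j]]; rewrite mem_filter => /andP[/= ij _] ->.
      exists (v_form i + (-1) ^+ false *: v_form j - (2 * s)%:~R *: z_form).
        exact: FormS.
      by rewrite -short_hyperplane scale1r.
    exists (v_form i + (-1) ^+ true *: v_form j - (2 * s)%:~R *: z_form).
      exact: FormS.
    by rewrite -short_hyperplane expr1 scaleN1r.
  case/mapP: uS => i _ ->; exists (v_form i - s%:~R *: z_form); first exact: FormV.
  by rewrite -long_hyperplane.
case=> _ [|i c cm|i j s b ij sa] ->; first by rewrite kernel_ofE eqxx.
  apply/orP; right; apply/mapP; exists (2 *: coord_form R i, c%:~R); last first.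
    by rewrite long_hyperplane.
  rewrite mem_cat; apply/orP; right.
  by apply: (allpairs_f (fun u (s : int) => (u, s%:~R))) => //; apply: map_f; rewrite mem_enum.
apply/orP; right; apply/mapP.
exists (coord_form R i + (-1) ^+ b *: coord_form R j, s%:~R); last first.
  by rewrite short_hyperplane.
rewrite mem_cat; apply/orP; left.
apply: (allpairs_f (fun u (s : int) => (u, s%:~R))); last by rewrite mem_int_range.
have ijS : (i, j) \in [seq p : 'I_l * 'I_l <- enum {: 'I_l * 'I_l} | (p.1 < p.2)%N].
  by rewrite mem_filter ij mem_enum.
rewrite mem_cat; apply/orP; case: b; [right|left]; apply/mapP; exists (i, j) => //.
  by rewrite expr1 scaleN1r.
by rewrite scale1r.
Qed.

End Cone.

(** * The flag *)

Lemma intr_signM (R : pzRingType) (b : bool) (x : int) :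
  ((-1) ^+ b * x)%:~R = (-1) ^+ b * x%:~R :> R.
Proof. by rewrite rmorphM rmorphXn rmorphN1. Qed.

Section LfunEval.
Variables (R : realType) (V : vectType R).
Implicit Types f g h : 'Hom(V, R^o).

Lemma lfunBZ f h (k : R) x : (f - k *: h) x = f x - k * h x.
Proof. by rewrite add_lfunE opp_lfunE scale_lfunE. Qed.

Lemma lfunDZBZ f g h (c k : R) x :
  (f + c *: g - k *: h) x = f x + c * g x - k * h x.
Proof. by rewrite lfunBZ add_lfunE scale_lfunE. Qed.

End LfunEval.

Section Flag.
Variables (R : realType) (l m a : nat).
Local Notation V := 'rV[R]_(l + 1).
Local Notation z := (@z_form R l).
Local Notation v := (@v_form R l).

(** The value of v_j / z on the flag, obtained from m at the last index by adding 2 a at each step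
    down; indices start at 0. *)
Definition corner (j : nat) : int := (m + 2 * (a * (l - j.+1)))%N%:Z.

(** [insub j.+1] fails exactly for the last index. *)
Definition flag_hyperplane (j : 'I_l) : {vspace V} :=
  if insub j.+1 is Some j'
  then lker (v j + (-1) ^+ true *: v j' - (2 * a%:Z)%:~R *: z)
  else lker (v j - m%:Z%:~R *: z).

(** The bound is shifted so that [flag_space d.+1] fixes v_j for j >= d and leaves z and d further
    coordinates free, which makes dimension d + 1. *)
Definition flag_space (d : nat) : {vspace V} :=
  (\bigcap_(H <- [seq flag_hyperplane j | j : 'I_l <- enum 'I_l & (d <= j.+1)%N]) H)%VS.

Lemma flag_hyperplane_cone j : flag_hyperplane j \in cone (C0 R l m a).
Proof.
apply/mem_cone_C0; rewrite /flag_hyperplane; case: insubP => [j' _ jj'|_].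
  exists (v j + (-1) ^+ true *: v j' - (2 * a%:Z)%:~R *: z) => //.
  by apply: FormS => //; rewrite jj'.
exists (v j - m%:Z%:~R *: z) => //; apply: FormV.
by rewrite mem_int_range.
Qed.

Lemma flag_space_lattice d : in_lattice (cone (C0 R l m a)) (flag_space d).
Proof.
eexists; last reflexivity.
by move=> _ /mapP[j _ ->]; exact: flag_hyperplane_cone.
Qed.

Lemma mem_flag_space d x : x \in flag_space d.+1 <->
  (forall j : 'I_l, (d <= j)%N -> v j x = (corner j)%:~R * z x).
Proof.
rewrite mem_bigcap_seq all_map; split=> [/allP xH|xv]; last first.
  apply/allP => j; rewrite mem_filter /= ltnS => /andP[dj _].
  rewrite /flag_hyperplane; case: insubP => [j' _ jj'|lj]; rewrite memv_ker.
    rewrite lfunDZBZ expr1 mulN1r !xv //; last by rewrite jj' (leq_trans dj).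
    rewrite -mulNr -rmorphN -mulrDl -rmorphD -mulrBl -rmorphB.
    have -> : corner j + - corner j' - 2 * a%:Z = 0.
      by rewrite /corner jj'; have := ltn_ord j'; rewrite jj'; nia.
    by rewrite mul0r.
  rewrite lfunBZ xv // -mulrBl -rmorphB.
  have -> : corner j - m%:Z = 0 by rewrite /corner; move: lj; nia.
  by rewrite mul0r.
(* Induction on l - j: the last coordinate is fixed first, and each hyperplane then fixes the one
   before. *)
suff H n (j : 'I_l) : (l - j <= n)%N -> (d <= j)%N -> v j x = (corner j)%:~R * z x.
  by move=> j; apply: H (leqnn _).
elim: n j => [|n IHn] j jn dj; first by have := ltn_ord j; lia.
have : x \in flag_hyperplane j by apply: xH; rewrite mem_filter mem_enum ltnS dj.
rewrite /flag_hyperplane; case: insubP => [j' _ jj'|lj]; rewrite memv_ker.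
  rewrite lfunDZBZ expr1 mulN1r (IHn j') ?jj'; [|lia|lia].
  rewrite subr_eq add0r subr_eq -mulrDl -rmorphD => /eqP ->.
  congr (_%:~R * _); rewrite /corner; have := ltn_ord j'; rewrite jj'; nia.
rewrite lfunBZ subr_eq0 => /eqP ->.
congr (_%:~R * _); rewrite /corner; move: lj; nia.
Qed.

Lemma coordinates_z_v (x : V) : z x = 0 -> (forall i, v i x = 0) -> x = 0.
Proof.
move=> zx vx; apply/rowP => k; rewrite mxE -[k]splitK; case: (split k) => k' /=.
  by have /eqP := vx k'; rewrite v_formE mulf_eq0 pnatr_eq0 => /eqP.
by rewrite ord1 -[RHS]zx z_formE.
Qed.

(** * The restriction to one space of the flag *)

Section Level.
Variable d : nat.
Hypothesis dl : (d <= l)%N.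
Local Notation X := (flag_space d.+1).

(** Parametrises [flag_space d.+1] in order to compute its dimension. The free parameters are z and
    the x_j with j < d, while [corner] is a value of v_j = 2 x_j, hence the half. *)
Definition flag_embedding (u : 'rV[R]_(1 + d)) : V :=
  row_mx (\row_j (if insub (j : nat) is Some i then u 0 (rshift 1 i)
                  else (corner j)%:~R / 2 * u 0 (lshift d 0)))
         (u 0 (lshift d 0))%:M.

Lemma flag_embedding_is_linear : linear flag_embedding.
Proof.
move=> c u w; rewrite /flag_embedding scale_row_mx add_row_mx.
congr row_mx; last by apply/rowP => k; rewrite ord1 !mxE !eqxx.
apply/rowP => j; rewrite !mxE; case: insubP => [i _ _|_]; rewrite ?mxE //.
by rewrite mulrDr mulrCA.
Qed.

HB.instance Definition _ := GRing.isLinear.Build R 'rV[R]_(1 + d) V _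
  flag_embedding flag_embedding_is_linear.

Lemma z_flag_embedding u : z (flag_embedding u) = u 0 (lshift d 0).
Proof. by rewrite z_formE row_mxEr mxE eqxx. Qed.

Lemma v_flag_embedding u (j : 'I_l) : v j (flag_embedding u) =
  if insub (j : nat) is Some i then 2 * u 0 (rshift 1 i)
  else (corner j)%:~R * u 0 (lshift d 0).
Proof.
rewrite v_formE row_mxEl mxE; case: insubP => // _.
by rewrite mulrA [2 * _]mulrC divfK ?pnatr_eq0.
Qed.

Lemma dim_flag_space : \dim X = d.+1.
Proof.
have -> : X = limg (linfun flag_embedding).
  apply/vspaceP => x; apply/idP/idP => [/mem_flag_space xX|/memv_imgP[u _ ->]].
    pose u : 'rV[R]_(1 + d) := row_mx (z x)%:M
      (\row_i (x 0 (lshift 1 (widen_ord dl i)))).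
    have ul : u 0 (lshift d 0) = z x by rewrite row_mxEl mxE eqxx.
    suff -> : x = linfun flag_embedding u by apply: memv_img; apply: memvf.
    rewrite lfunE; apply/eqP; rewrite -subr_eq0; apply/eqP; apply: coordinates_z_v.
      by rewrite linearB /= z_flag_embedding ul subrr.
    move=> j; rewrite linearB /= v_flag_embedding; case: insubP => [i _ ij|].
      rewrite row_mxEr mxE v_formE; have -> : widen_ord dl i = j by apply: val_inj.
      by rewrite subrr.
    by rewrite -leqNgt => dj; rewrite ul xX // subrr.
  rewrite lfunE; apply/mem_flag_space => j dj.
  by rewrite v_flag_embedding z_flag_embedding insubN // -leqNgt.
rewrite limg_dim_eq; first by rewrite dimvf; exact: mul1n (1 + d).
apply/eqP; rewrite -subv0; apply/subvP => u; rewrite memv_cap memv_ker lfunE memv0.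
move=> /andP[_ /eqP /= u0]; apply/eqP/rowP => k; rewrite mxE -[k]splitK.
case: (split k) => k' /=.
  by rewrite ord1 -[lshift d ord0]/(lshift d 0) -z_flag_embedding u0 linear0.
have := v_flag_embedding u (widen_ord dl k'); rewrite u0 linear0 /=.
by rewrite valK => /esym/eqP; rewrite mulf_eq0 pnatr_eq0 => /eqP.
Qed.

Local Notation z' := (restrict_form X z).
Definition flag_form (i : 'I_d) := restrict_form X (v (widen_ord dl i)).
Local Notation v' := flag_form.
(** For d = l these are all integers from -m to m. Each eliminated coordinate lengthens the first
    progression by a terms at both ends. *)
Let cs := sym_range (m.+1 + 2 * (a * (l - d))) ++ sym_range m.

Lemma restrict_corner (j : 'I_l) : (d <= j)%N ->
  restrict_form X (v j) = (corner j)%:~R *: z'.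
Proof.
move=> dj; apply/lfunP => u; rewrite scale_lfunE !restrict_formE.
by have /mem_flag_space -> := subvsP u.
Qed.

Lemma restrict_inj u : z' u = 0 -> (forall i, v' i u = 0) -> u = 0.
Proof.
rewrite restrict_formE => zu vu; apply: val_inj; apply: coordinates_z_v => // j.
have [jd|dj] := ltnP j d.
  have := vu (Ordinal jd); rewrite /flag_form restrict_formE.
  by have -> : widen_ord dl (Ordinal jd) = j by apply: val_inj.
have /mem_flag_space uX := subvsP u.
by rewrite uX // zu mulr0.
Qed.

Lemma dim_restriction : (1 + d)%N = \dim {:subvs_of X}.
Proof. by rewrite dimvf; apply/esym/dim_flag_space. Qed.

Lemma ord_widen (j : 'I_l) : (j < d)%N -> exists i : 'I_d, j = widen_ord dl i.
Proof. by move=> jd; exists (Ordinal jd); apply: val_inj. Qed.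

Lemma int_range_cs c : c \in int_range m -> c \in cs.
Proof.
rewrite mem_int_range mem_cat !mem_sym_range; move: (a * _)%N => q; lia.
Qed.

(** The equation v_i +- v_j = 2 s z with v_j = corner j z becomes v_i = c z, where c has the parity
    of m and |c| <= m + 2 a (l - d): a term of the first progression. *)
Lemma corner_cs (j : 'I_l) s (b : bool) : (d <= j)%N -> (`|s| <= a)%N ->
  2 * s - (-1) ^+ b * corner j \in cs.
Proof.
move=> dj sa; have := ltn_ord j => jl.
have : (a * (l - j.+1) + a <= a * (l - d))%N by rewrite -mulnSr leq_mul //; lia.
rewrite mem_cat !mem_sym_range /corner.
by move: (a * (l - j.+1))%N (a * (l - d))%N => p q pq; case: b; rewrite ?expr1 ?expr0; lia.
Qed.

(** Outside [-m, m] only the first progression contributes, and there |c| = m + 2 t with 0 < t <= a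
    (l - d). *)
Lemma cs_corner c : c \in cs -> c \notin int_range m ->
  exists (j : 'I_l) s (b : bool),
    [/\ (d <= j)%N, (`|s| <= a)%N & c = 2 * s - (-1) ^+ b * corner j].
Proof.
rewrite mem_int_range mem_cat !mem_sym_range -ltnNge => cc mc.
have {cc} : exists2 t, (0 < t <= a * (l - d))%N & `|c|%N = (m + 2 * t)%N.
  exists (`|c| - m)./2; move: cc mc; move: (a * _)%N => q; lia.
move=> [t /andP[t0 tq] cE]; have a0 : (0 < a)%N by move: t0 tq; case: (a) => //; lia.
(* Dividing t - 1 instead of t by a gives t = k a + s with 1 <= s <= a; then m + 2 t = corner j + 2
   s for j = l - k - 1. *)
pose k := (t.-1 %/ a)%N.
have kl : (k < l - d)%N by rewrite ltn_divLR // mulnC; lia.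
have tE : (t.-1 = k * a + t.-1 %% a)%N by exact: divn_eq.
have ta : (t.-1 %% a < a)%N by rewrite ltn_mod.
have jl : (l - k.+1 < l)%N by lia.
have lj : (l - (l - k.+1).+1 = k)%N by lia.
exists (Ordinal jl), (if 0 <= c then (t.-1 %% a).+1%:Z else - (t.-1 %% a).+1%:Z), (0 <= c).
rewrite /corner /= lj; move: tE ta; rewrite [(k * a)%N]mulnC.
move: (a * k)%N (t.-1 %% a)%N => p s tE sa.
by case: ifP => c0; split; rewrite ?expr1 ?expr0; lia.
Qed.

(** A form keeps its shape if all its indices are below d. A form in v_i and v_j with i < d <= j
    yields some v_i - c z, and one with all indices at least d a multiple of z; [cs_corner] provides
    the preimages of the new values c. *)
Lemma mem_flag_restriction (A : arrangement V) H : A =i cone (C0 R l m a) ->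
  H \in restriction A X <->
  exists2 f, type_C_form z' v' cs a f & H = lker f.
Proof.
move=> AE; have neq0 := type_C_form_neq0 dim_restriction restrict_inj.
have AC H0 : H0 \in A <->
    exists2 f, type_C_form z v (int_range m) a f & H0 = lker f.
  by rewrite AE; exact: mem_cone_C0.
apply: (iff_trans (mem_restriction _ AC)); split.
  move=> [f [Cf]].
  have const (k : int) : (k%:~R : R) *: z' != 0 -> exists2 g,
      type_C_form z' v' cs a g & lker (k%:~R *: z') = lker g.
    move=> kz; exists z'; [exact: FormZ | apply: lker_scale].
    by apply: contraNneq kz => ->; rewrite scale0r.
  case: Cf => [|i c cm|i j s b ij sa] f0 ->.
  - by exists z'; [exact: FormZ |].
  - move: f0; rewrite restrict_formBZ; have [/ord_widen[i' ->] _|di] := ltnP i d.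
      by exists (v' i' - c%:~R *: z') => //; apply: FormV; exact: int_range_cs.
    by rewrite restrict_corner // -scalerBl -rmorphB; exact: const.
  - move: f0; rewrite restrict_formDZBZ.
    have [jd|dj] := ltnP j d.
      have [j' jE] := ord_widen jd; have [i' iE] := ord_widen (ltn_trans ij jd).
      rewrite jE iE => _; eexists; last reflexivity; apply: FormS => //.
      by move: ij; rewrite jE iE.
    rewrite [restrict_form X (v j)]restrict_corner // scalerA.
    have [/ord_widen[i' ->] _|di] := ltnP i d.
      exists (v' i' - (2 * s - (-1) ^+ b * corner j)%:~R *: z').
        by apply: FormV; exact: corner_cs.
      by rewrite rmorphB /= intr_signM scalerBl opprB addrA.
    rewrite restrict_corner // -scalerDl -scalerBl.
    have -> : (corner i)%:~R + (-1) ^+ b * (corner j)%:~R - (2 * s)%:~R =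
      (corner i + (-1) ^+ b * corner j - 2 * s)%:~R :> R.
      by rewrite -intr_signM -rmorphD -rmorphB.
    exact: const.
move=> [f' Cf' ->]; have f'0 := neq0 _ _ _ Cf'.
suff [f Cf fE] : exists2 f, type_C_form z v (int_range m) a f & restrict_form X f = f'.
  by exists f; rewrite fE.
case: Cf' => [|i c cc|i j s b ij sa].
- by exists z; [exact: FormZ |].
- have [cm|cm] := boolP (c \in int_range m).
    exists (v (widen_ord dl i) - c%:~R *: z); first exact: FormV.
    by rewrite restrict_formBZ.
  have [j [s [b [dj sa ->]]]] := cs_corner cc cm.
  exists (v (widen_ord dl i) + (-1) ^+ b *: v j - (2 * s)%:~R *: z).
    by apply: FormS => //; rewrite /= (leq_trans (ltn_ord i)).
  rewrite restrict_formDZBZ [restrict_form X (v j)]restrict_corner // scalerA.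
  by rewrite [in RHS]rmorphB /= intr_signM scalerBl opprB addrA.
- exists (v (widen_ord dl i) + (-1) ^+ b *: v (widen_ord dl j) - (2 * s)%:~R *: z).
    exact: FormS.
  by rewrite restrict_formDZBZ.
Qed.

End Level.

Hypothesis hl : (0 < l)%N.

Definition C0_exponents : seq nat :=
  1%N :: [seq (2 * m + 1 + 2 * (a * l.-1) + 2 * k)%N | k <- iota 0 l].

(** At level d the exponents after 1 start from r1 + r2 + 2 a (d - 1) with r1 + r2 = 2 m + 1 + 2 a
    (l - d). This is 2 m + 1 + 2 a (l - 1) whatever d is, so the exponents of the restrictions are
    initial segments. *)
Theorem flag_accurate_C0 (A : arrangement V) : A =i cone (C0 R l m a) ->
  flag_accurate_with_exponents A C0_exponents.
Proof.
move=> AE; have dimE : \dim {:V} = l.+1 by rewrite dimvf; apply: etrans (addn1 l); exact: mul1n.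
have al : (a * l = a * l.-1 + a)%N by rewrite -mulnSr prednK.
split.
- by rewrite /= size_map size_iota dimE.
- rewrite /= path_min_sorted; last first.
    apply/allP => _ /mapP[k _ ->].
    by rewrite /= addnAC !addn_gt0 orbT.
  rewrite sorted_map; apply: (sub_sorted _ (iota_sorted 0 l)) => i j /=.
  by rewrite leq_add2l; lia.
- apply: (@type_C_free _ _ l z v _ _ A m.+1 m a _ (int_range m)).
  + by rewrite dimE.
  + exact: coordinates_z_v.
  + lia.
  + by move=> c; rewrite mem_int_range mem_cat !mem_sym_range; lia.
  + by rewrite [(l * a)%N]mulnC al; lia.
  + by move=> H; rewrite AE; exact: mem_cone_C0.
exists flag_space; rewrite dimE; split.
- apply/vspaceP => x; rewrite memvf; apply/mem_flag_space => j lj.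
  by have := ltn_ord j; rewrite ltnNge lj.
- move=> [|d] // _; apply/subvP => x /mem_flag_space xd; apply/mem_flag_space => j dj.
  exact/xd/ltnW.
move=> [|d] // /andP[_]; rewrite ltnS => dl; split.
- have [B BC XE] := flag_space_lattice d.+1; exists B => // H /BC.
  by rewrite AE.
- exact: dim_flag_space.
rewrite /= -map_take take_iota (minn_idPl dl).
have ald : (a * l = a * (l - d) + a * d)%N by rewrite -mulnDr subnK.
apply: (type_C_free (dim_restriction dl) (@restrict_inj d dl)
  (r1 := m.+1 + 2 * (a * (l - d))) (r2 := m) (a := a)).
- by move: (a * _)%N => q; lia.
- by move=> c.
- by rewrite [(d * a)%N]mulnC; lia.
- by move=> H; exact: mem_flag_restriction.
Qed.

End Flag.

Lemma CatC_C0 (R : realType) (l m : nat) : CatC R l m = C0 R l m m.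
Proof. by rewrite /CatC /C0 /deformation allpairs_cat. Qed.

Theorem theorem5p13 (R : realType) (l m a : nat) (hl : (1 <= l)%N) :
  flag_accurate (cone (C0 R l m a)) /\
  CatC R l m =i C0 R l m m /\
  flag_accurate_with_exponents (cone (CatC R l m))
    (1%N :: [seq (2 * m * l + 2 * i - 1)%N | i <- iota 1 l]).
Proof.
split; first by exists (C0_exponents l m a); apply: flag_accurate_C0.
rewrite CatC_C0; split=> //.
(* For a = m, 2 m + 1 + 2 m (l - 1) + 2 k equals 2 m l + 2 (k + 1) - 1. *)
have -> : [seq (2 * m * l + 2 * i - 1)%N | i <- iota 1 l] = behead (C0_exponents l m m).
  rewrite /= -[1%N]addn0 iotaDl -map_comp; apply: eq_map => k /=.
  have : (m * l = m * l.-1 + m)%N by rewrite -mulnSr prednK.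
  by move: (m * l.-1)%N => q; rewrite -mulnA => ->; lia.
exact: flag_accurate_C0.
Qed.
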